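(* Let $K$ be an algebraically closed field, $Q$ a finite connected acyclic quiver, and $\Lambda=KQ$ a representation-finite hereditary $K$-algebra. Then: (a) If the underlying graph $\overline{Q}$ of $Q$ is a Dynkin diagram $\mathbb{D}_n$ for some $n\ge 4$, then $\Lambda$ is a $(2n-3)$-Nakayama algebra. (b) If $\overline{Q}$ is the Dynkin diagram $\mathbb{E}_6$, then $\Lambda$ is an $11$-Nakayama algebra. (c) If $\overline{Q}$ is the Dynkin diagram $\mathbb{E}_7$, then $\Lambda$ is a $17$-Nakayama algebra. (d) If $\overline{Q}$ is the Dynkin diagram $\mathbb{E}_8$, then $\Lambda$ is a $29$-Nakayama algebra.
   Context: All modules are finitely generated. For a (left or right) module $M$ put $\mathrm{rad}^0(M)=M$, $\mathrm{rad}^{i+1}(M)=\mathrm{rad}(\mathrm{rad}^i(M))$. A module is uniserial if it has a unique composition series (the zero module counts as uniserial). Let $M$ be a nonzero module of length $l$. $M$ is $1$-factor serial if it is uniserial; for $l\ge m>1$, $M$ is $m$-factor serial if $M/\mathrm{rad}^{l-m}(M)$ is uniserial and $M/\mathrm{rad}^{l-m+1}(M)$ is not uniserial. An algebra $\Lambda$ is right (resp. left) $m$-Nakayama if every indecomposable right (resp. left) $\Lambda$-module is $i$-factor serial for some $1\le i\le m$ and there exists at least one indecomposable $m$-factor serial right (resp. left) $\Lambda$-module. $\Lambda$ is $m$-Nakayama if it is both right $m$-Nakayama and left $m$-Nakayama. *)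

(* Defs.v *)
From HB Require Import structures.
From mathcomp Require Import all_boot all_order all_algebra.
From mathcomp Require Import finmap monalg.
From mathcomp Require Import boolp.

Set Implicit Arguments.
Unset Strict Implicit.
Unset Printing Implicit Defensive.

Import GRing.Theory.
Local Open Scope fset_scope.
Local Open Scope quotient_scope.
Local Open Scope ring_scope.

(** Left modules over a ring [R] are the inhabitants of [lmodType R]; right
    [R]-modules are left modules over the converse ring [R^c]. *)

Section Submodules.
Context {R : pzRingType} {M : lmodType R}.

Record submodule := Submodule {
  subm_pred :> {pred M};
  subm_closed : submod_closed subm_pred }.

HB.instance Definition _ (N : submodule) :=
  GRing.isSubmodClosed.Build R M (subm_pred N)
    (GRing.submod_closed_semi (subm_closed N)).

Lemma submodule_eq (N L : submodule) : N =i L -> N = L.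
Proof.
case: N L => [N hN] [L hL] /= NL.
have eNL : N = L by apply: funext => x; exact: NL.
by subst L; congr Submodule; exact: Prop_irrelevance.
Qed.

Fact subm0_closed : submod_closed (pred1 (0 : M)).
Proof.
split=> [|a u v]; first exact: eqxx.
by rewrite !inE => /eqP-> /eqP->; rewrite scaler0 addr0.
Qed.
Definition subm0 : submodule := Submodule subm0_closed.

Fact submT_closed : submod_closed (predT : {pred M}).
Proof. by []. Qed.
Definition submT : submodule := Submodule submT_closed.

Definition maximal_submodule (L N : submodule) : Prop :=
  [/\ {subset L <= N}, L <> N &
      forall P : submodule, {subset L <= P} -> {subset P <= N} ->
        P = L \/ P = N].

Definition rad_pred (N : submodule) : {pred M} :=
  fun x => `[< x \in N /\
              forall L : submodule, maximal_submodule L N -> x \in L >].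

Fact rad_closed N : submod_closed (rad_pred N).
Proof.
split=> [|a u v].
  by apply/asboolP; split=> [|L _]; exact: rpred0.
move=> /asboolP[uN uL] /asboolP[vN vL]; apply/asboolP; split=> [|L mL].
  by rewrite rpredD ?rpredZ.
by rewrite rpredD ?rpredZ ?uL ?vL.
Qed.

(** The radical of the module [N]: the intersection of the maximal submodules
    of [N] ([N] itself when there are none). *)
Definition rad (N : submodule) : submodule := Submodule (rad_closed N).

(** [comp_series_from N [:: N_1; ...; N_l]] says that
    [N < N_1 < ... < N_l = M] with each term maximal in the next one. *)
Fixpoint comp_series_from (N : submodule) (s : seq submodule) : Prop :=
  if s is L :: s' then maximal_submodule N L /\ comp_series_from L s'
  else N = submT.

End Submodules.
Arguments submodule {R} M.
Arguments subm0 {R} M.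
Arguments submT {R} M.

(** The trivial first term [0] of a composition series is left implicit, so
    that the length of the module is the size of the sequence. *)
Definition composition_series (R : pzRingType) (M : lmodType R)
    (s : seq (submodule M)) : Prop := comp_series_from (subm0 M) s.

Definition has_length (R : pzRingType) (M : lmodType R) (l : nat) : Prop :=
  exists2 s : seq (submodule M), composition_series s & size s = l.

Definition uniserial (R : pzRingType) (M : lmodType R) : Prop :=
  exists! s : seq (submodule M), composition_series s.

Definition radn (R : pzRingType) (M : lmodType R) (i : nat) : submodule M :=
  iter i rad (submT M).

Section QuotientModule.
Context {R : pzRingType} {M : lmodType R} (N : submodule M).

Definition quotm : Type := Quotient.quot (subm_pred N).

HB.instance Definition _ := GRing.Zmodule.on quotm.
HB.instance Definition _ := EqQuotient.on quotm.

Definition quotm_scale (a : R) : quotm -> quotm :=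
  lift_op1 quotm (fun x : M => a *: x).

Lemma pi_quotm_scale a (x : M) :
  quotm_scale a (\pi_quotm x) = \pi_quotm (a *: x).
Proof.
rewrite /quotm_scale; unlock; apply/eqP.
rewrite -(Quotient.idealrBE (subm_pred N)) -scalerBr rpredZ //.
by rewrite (Quotient.idealrBE (subm_pred N)) reprK.
Qed.

Let pi_quotmD (x y : M) : \pi_quotm (x + y) = \pi_quotm x + \pi_quotm y.
Proof. exact: (Quotient.pi_add (subm_pred N)). Qed.

Fact quotm_scaleA a b x : quotm_scale a (quotm_scale b x) = quotm_scale (a * b) x.
Proof. by elim/quotW: x => x; rewrite !pi_quotm_scale scalerA. Qed.

Fact quotm_scale1 : left_id 1 quotm_scale.
Proof. by elim/quotW => x; rewrite pi_quotm_scale scale1r. Qed.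

Fact quotm_scaleDr : right_distributive quotm_scale +%R.
Proof.
move=> a; elim/quotW => x; elim/quotW => y.
by rewrite -pi_quotmD !pi_quotm_scale scalerDr pi_quotmD.
Qed.

Fact quotm_scaleDl x : {morph quotm_scale^~ x : a b / a + b}.
Proof.
by elim/quotW: x => x a b; rewrite !pi_quotm_scale scalerDl pi_quotmD.
Qed.

HB.instance Definition _ := GRing.Zmodule_isLmodule.Build R quotm
  quotm_scaleA quotm_scale1 quotm_scaleDr quotm_scaleDl.

End QuotientModule.

Section ModuleProperties.
Context {R : pzRingType}.
Implicit Types M P : lmodType R.

Definition finitely_generated M : Prop :=
  exists (n : nat) (g : 'I_n -> M), forall x : M,
    exists c : 'I_n -> R, x = \sum_i c i *: g i.

Definition nonzero_module M : Prop := exists x : M, x != 0.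

Definition indecomposable M : Prop :=
  nonzero_module M /\
  forall A B : submodule M,
    (forall x, exists a b, [/\ a \in A, b \in B & x = a + b]) ->
    (forall x, x \in A -> x \in B -> x = 0) ->
    A = subm0 M \/ B = subm0 M.

Definition isomorphic M P : Prop := exists f : {linear M -> P}, bijective f.

Definition projective P : Prop :=
  forall (X Y : lmodType R) (g : {linear X -> Y}) (h : {linear P -> Y}),
    (forall y, exists x, g x = y) ->
    exists k : {linear P -> X}, forall p, g (k p) = h p.

Definition factor_serial (m : nat) M : Prop :=
  nonzero_module M /\
  ((m = 1%N /\ uniserial M) \/
   exists2 l, has_length M l &
     [/\ (1 < m <= l)%N, uniserial (quotm (radn M (l - m)%N))
       & ~ uniserial (quotm (radn M (l - m + 1)%N))]).

End ModuleProperties.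

Section AlgebraProperties.

Definition left_nakayama (R : pzRingType) (m : nat) : Prop :=
  (forall M : lmodType R, finitely_generated M -> indecomposable M ->
     exists2 i, (1 <= i <= m)%N & factor_serial i M) /\
  (exists M : lmodType R,
     [/\ finitely_generated M, indecomposable M & factor_serial m M]).

Definition right_nakayama (R : pzRingType) (m : nat) : Prop :=
  left_nakayama R^c m.

Definition nakayama (K : fieldType) (A : algType K) (m : nat) : Prop :=
  right_nakayama A m /\ left_nakayama A m.

Definition left_representation_finite (R : pzRingType) : Prop :=
  exists (n : nat) (F : 'I_n -> lmodType R),
    forall M : lmodType R, finitely_generated M -> indecomposable M ->
      exists i, isomorphic M (F i).

Definition representation_finite (K : fieldType) (A : algType K) : Prop :=
  left_representation_finite A^c /\ left_representation_finite A.

(** Submodules are presented up to isomorphism, as injective linear maps. *)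
Definition left_hereditary (R : pzRingType) : Prop :=
  forall (N P : lmodType R) (f : {linear N -> P}),
    finitely_generated N -> finitely_generated P ->
    injective f -> projective P -> projective N.

Definition hereditary (K : fieldType) (A : algType K) : Prop :=
  left_hereditary A^c /\ left_hereditary A.

End AlgebraProperties.

Record quiver := Quiver {
  vertex : finType;
  arrow : finType;
  source : arrow -> vertex;
  target : arrow -> vertex;
  vertex_gt0 : (0 < #|vertex|)%N }.

Section Paths.
Variable Q : quiver.
Implicit Types (v : vertex Q) (s : seq (arrow Q)).

Fixpoint is_qpath v s : bool :=
  if s is a :: s' then (source a == v) && is_qpath (target a) s' else true.

Definition endpoint v s : vertex Q := last v (map (@target Q) s).

(** A path is its starting vertex together with the consecutive arrows; the
    trivial path at [v] is [(v, [::])]. *)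
Record qpath := QPath {
  qpath_val : vertex Q * seq (arrow Q);
  _ : is_qpath qpath_val.1 qpath_val.2 }.

HB.instance Definition _ := [isSub for qpath_val].
HB.instance Definition _ := [Choice of qpath by <:].

Definition qsource (p : qpath) : vertex Q := (val p).1.
Definition qarrows (p : qpath) : seq (arrow Q) := (val p).2.
Definition qtarget (p : qpath) : vertex Q := endpoint (qsource p) (qarrows p).
Definition qtriv v : qpath := @QPath (v, [::]) isT.

(** First [p], then [q]. *)
Definition qcomp (p q : qpath) : option qpath :=
  if qtarget p == qsource q then insub (qsource p, qarrows p ++ qarrows q)
  else None.

Lemma is_qpath_cat v s t :
  is_qpath v (s ++ t) = is_qpath v s && is_qpath (endpoint v s) t.
Proof. by elim: s v => //= a s IHs v; rewrite IHs andbA. Qed.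

Lemma endpoint_cat v s t : endpoint v (s ++ t) = endpoint (endpoint v s) t.
Proof. by rewrite /endpoint map_cat last_cat. Qed.

Variant qcomp_spec (p q : qpath) : option qpath -> Prop :=
| QCompSome r of qtarget p = qsource q & qsource r = qsource p
    & qarrows r = qarrows p ++ qarrows q & qtarget r = qtarget q :
    qcomp_spec p q (Some r)
| QCompNone of qtarget p <> qsource q : qcomp_spec p q None.

Lemma qcompP p q : qcomp_spec p q (qcomp p q).
Proof.
rewrite /qcomp; case: eqP => [pq|]; last exact: QCompNone.
have pqP : is_qpath (qsource p) (qarrows p ++ qarrows q).
  rewrite is_qpath_cat -[endpoint _ _]/(qtarget p) pq.
  by rewrite (valP p) (valP q).
rewrite insubT /=; apply: QCompSome => //=.
by rewrite /qtarget /= endpoint_cat -[endpoint _ (qarrows p)]/(qtarget p) pq.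
Qed.

Lemma qpath_eq p q : qsource p = qsource q -> qarrows p = qarrows q -> p = q.
Proof.
move=> e1 e2; apply: val_inj.
by rewrite [val p]surjective_pairing [val q]surjective_pairing; congr pair.
Qed.

Lemma qcompA p q r :
  obind (qcomp p) (qcomp q r) = obind (qcomp^~ r) (qcomp p q).
Proof.
case: (qcompP q r) => [y qr y1 y2 y3|qr];
  case: (qcompP p q) => [x pq x1 x2 x3|pq] //=.
- case: (qcompP p y) => [z _ z1 z2 _|]; last by rewrite y1.
  case: (qcompP x r) => [t _ t1 t2 _|]; last by rewrite x3.
  by congr Some; apply: qpath_eq; rewrite ?z1 ?t1 // z2 t2 y2 x2 catA.
- by case: (qcompP p y) => // z; rewrite y1.
- by case: (qcompP x r) => // z; rewrite x3.
Qed.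

Lemma qcomp1p v p : qcomp (qtriv v) p = if v == qsource p then Some p else None.
Proof.
case: (qcompP (qtriv v) p) => [x|]; rewrite /qtarget /= => /eqP.
  move=> vp x1 x2 _; rewrite vp; congr Some.
  by apply: qpath_eq; rewrite ?x1 ?x2 //; apply/eqP.
by move/negPf->.
Qed.

Lemma qcompp1 v p : qcomp p (qtriv v) = if v == qtarget p then Some p else None.
Proof.
rewrite eq_sym; case: (qcompP p (qtriv v)) => [x|] /eqP.
  move=> vp x1 x2 _; rewrite [_ == _]vp; congr Some.
  by apply: qpath_eq; rewrite ?x1 ?x2 ?cats0.
by move/negPf=> h; rewrite [_ == _]h.
Qed.

End Paths.

Section PathAlgebra.
Variables (K : fieldType) (Q : quiver).

(** The path algebra [KQ]: finitely supported linear combinations of paths. *)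
Definition pathalg : Type := {malg K[qpath Q]}.

HB.instance Definition _ := GRing.Lmodule.on pathalg.

Implicit Types (f g h : pathalg) (p q : qpath Q) (c d : K).

Definition pathalgU c (o : option (qpath Q)) : pathalg :=
  if o is Some p then << c *g p >> else 0.

Definition pathalg_one : pathalg := \sum_v << 1 *g qtriv v >>.

(** The bilinear extension of concatenation of paths, where the product of two
    paths that cannot be concatenated is [0]. *)
Definition pathalg_mul f g : pathalg :=
  \sum_(p <- msupp f) \sum_(q <- msupp g) pathalgU (f@_p * g@_q) (qcomp p q).

Lemma pathalgU0 o : pathalgU 0 o = 0.
Proof. by case: o => //= p; rewrite monalgU0. Qed.

Lemma pathalgUD c d o : pathalgU (c + d) o = pathalgU c o + pathalgU d o.
Proof. by case: o => [p|] /=; rewrite ?addr0 // monalgUD. Qed.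

Lemma pathalgUZ c d o : c *: pathalgU d o = pathalgU (c * d) o.
Proof.
case: o => [p|] /=; last by rewrite scaler0.
by apply/malgP => k; rewrite mcoeffZ !mcoeffU mulrnAr.
Qed.

Lemma pathalg_mulw (d1 d2 : {fset qpath Q}) f g :
  msupp f `<=` d1 -> msupp g `<=` d2 ->
  pathalg_mul f g =
    \sum_(p <- d1) \sum_(q <- d2) pathalgU (f@_p * g@_q) (qcomp p q).
Proof.
move=> le_d1 le_d2; rewrite /pathalg_mul (big_fset_incl _ le_d1) /=.
  apply/eq_bigr=> p _; apply/big_fset_incl => // k _ /mcoeff_outdom ->.
  by rewrite mulr0 pathalgU0.
move=> p _ /mcoeff_outdom fp.
by rewrite big1 // => q _; rewrite fp mul0r pathalgU0.
Qed.

Lemma pathalg_mulDl : left_distributive pathalg_mul +%R.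
Proof.
move=> f g h.
rewrite (pathalg_mulw (msuppD_le f g) (fsubset_refl (msupp h))).
rewrite (pathalg_mulw (fsubsetUl (msupp f) (msupp g)) (fsubset_refl (msupp h))).
rewrite (pathalg_mulw (fsubsetUr (msupp f) (msupp g)) (fsubset_refl (msupp h))).
rewrite -big_split; apply: eq_bigr => p _; rewrite -big_split.
by apply: eq_bigr => q _; rewrite mcoeffD mulrDl pathalgUD.
Qed.

Lemma pathalg_mulDr : right_distributive pathalg_mul +%R.
Proof.
move=> h f g.
rewrite (pathalg_mulw (fsubset_refl (msupp h)) (msuppD_le f g)).
rewrite (pathalg_mulw (fsubset_refl (msupp h)) (fsubsetUl (msupp f) (msupp g))).
rewrite (pathalg_mulw (fsubset_refl (msupp h)) (fsubsetUr (msupp f) (msupp g))).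
rewrite -big_split; apply: eq_bigr => p _; rewrite -big_split.
by apply: eq_bigr => q _; rewrite mcoeffD mulrDr pathalgUD.
Qed.

Lemma pathalg_mul0l f : pathalg_mul 0 f = 0.
Proof. by rewrite /pathalg_mul msupp0 big_seq_fset0. Qed.

Lemma pathalg_mul0r f : pathalg_mul f 0 = 0.
Proof. by rewrite /pathalg_mul big1 // => p _; rewrite msupp0 big_seq_fset0. Qed.

Lemma pathalg_mulUU c d p q :
  pathalg_mul << c *g p >> << d *g q >> = pathalgU (c * d) (qcomp p q).
Proof.
by rewrite (pathalg_mulw msuppU_le msuppU_le) !big_seq_fset1 !mcoeffUU.
Qed.

Lemma pathalg_suml I (s : seq I) (F : I -> pathalg) g :
  pathalg_mul (\sum_(i <- s) F i) g = \sum_(i <- s) pathalg_mul (F i) g.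
Proof.
exact: (big_morph (pathalg_mul^~ g) (fun _ _ => pathalg_mulDl _ _ _)
  (pathalg_mul0l g)).
Qed.

Lemma pathalg_sumr I (s : seq I) (F : I -> pathalg) f :
  pathalg_mul f (\sum_(i <- s) F i) = \sum_(i <- s) pathalg_mul f (F i).
Proof.
exact: (big_morph (pathalg_mul f) (fun _ _ => pathalg_mulDr _ _ _)
  (pathalg_mul0r f)).
Qed.

Lemma pathalg_ind (P : pathalg -> Prop) :
  P 0 -> (forall f g, P f -> P g -> P (f + g)) ->
  (forall c p, P << c *g p >>) -> forall f, P f.
Proof.
move=> P0 PD PU f; rewrite [f]monalgE.
by elim/big_ind: _ => // p _; exact: PU.
Qed.

Lemma pathalg_mulA : associative pathalg_mul.
Proof.
move=> f g h; elim/pathalg_ind: f => [|f1 f2 IH1 IH2|c p].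
- by rewrite !pathalg_mul0l.
- by rewrite !pathalg_mulDl IH1 IH2.
elim/pathalg_ind: g => [|g1 g2 IH1 IH2|d q].
- by rewrite pathalg_mul0l pathalg_mul0r pathalg_mul0l.
- by rewrite pathalg_mulDl !pathalg_mulDr pathalg_mulDl IH1 IH2.
elim/pathalg_ind: h => [|h1 h2 IH1 IH2|e r].
- by rewrite !pathalg_mul0r.
- by rewrite !pathalg_mulDr IH1 IH2.
rewrite !pathalg_mulUU.
have -> : pathalg_mul << c *g p >> (pathalgU (d * e) (qcomp q r)) =
          pathalgU (c * (d * e)) (obind (qcomp p) (qcomp q r)).
  by case: (qcomp q r) => [y|] /=; rewrite ?pathalg_mul0r ?pathalg_mulUU.
rewrite qcompA mulrA.
by case: (qcomp p q) => [y|] /=; rewrite ?pathalg_mul0l ?pathalg_mulUU.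
Qed.

Lemma pathalg_mul1l : left_id pathalg_one pathalg_mul.
Proof.
move=> f; elim/pathalg_ind: f => [|f1 f2 IH1 IH2|c p].
- by rewrite pathalg_mul0r.
- by rewrite pathalg_mulDr IH1 IH2.
rewrite pathalg_suml (bigD1 (qsource p)) //= pathalg_mulUU qcomp1p eqxx /= mul1r.
rewrite big1 ?addr0 // => v vp.
by rewrite pathalg_mulUU qcomp1p (negPf vp).
Qed.

Lemma pathalg_mul1r : right_id pathalg_one pathalg_mul.
Proof.
move=> f; elim/pathalg_ind: f => [|f1 f2 IH1 IH2|c p].
- by rewrite pathalg_mul0l.
- by rewrite pathalg_mulDl IH1 IH2.
rewrite pathalg_sumr (bigD1 (qtarget p)) //= pathalg_mulUU qcompp1 eqxx /= mulr1.
rewrite big1 ?addr0 // => v vp.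
by rewrite pathalg_mulUU qcompp1 (negPf vp).
Qed.

Lemma pathalg_one_neq0 : pathalg_one != 0.
Proof.
have /card_gt0P[v _] := vertex_gt0 Q.
apply/eqP => /(congr1 (mcoeff (qtriv v))) /eqP.
rewrite raddf_sum (bigD1 v) //= big1 => [|w wv].
  by rewrite mcoeffUU mcoeff0 addr0 oner_eq0.
rewrite mcoeffU; case: eqP => // /(congr1 (@qsource Q)) vw.
by rewrite -[w]/(qsource (qtriv w)) vw eqxx in wv.
Qed.

HB.instance Definition _ := GRing.Zmodule_isNzRing.Build pathalg
  pathalg_mulA pathalg_mul1l pathalg_mul1r pathalg_mulDl pathalg_mulDr
  pathalg_one_neq0.

Lemma pathalg_scaleAl c f g : c *: (f * g) = c *: f * g.
Proof.
rewrite -[f * g]/(pathalg_mul f g) -[_ * g]/(pathalg_mul _ g).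
rewrite (pathalg_mulw (msuppZ_le c f) (fsubset_refl (msupp g))).
rewrite /pathalg_mul !scaler_sumr; apply: eq_bigr => p _.
rewrite scaler_sumr; apply: eq_bigr => q _.
by rewrite pathalgUZ mcoeffZ mulrA.
Qed.

Lemma pathalg_scaleAr c f g : c *: (f * g) = f * (c *: g).
Proof.
rewrite -[f * g]/(pathalg_mul f g) -[f * _]/(pathalg_mul f _).
rewrite (pathalg_mulw (fsubset_refl (msupp f)) (msuppZ_le c g)).
rewrite /pathalg_mul !scaler_sumr; apply: eq_bigr => p _.
rewrite scaler_sumr; apply: eq_bigr => q _.
by rewrite pathalgUZ mcoeffZ mulrCA.
Qed.

HB.instance Definition _ :=
  GRing.Lmodule_isLalgebra.Build K pathalg pathalg_scaleAl.
HB.instance Definition _ :=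
  GRing.Lalgebra_isAlgebra.Build K pathalg pathalg_scaleAr.

End PathAlgebra.

Definition acyclic (Q : quiver) : Prop :=
  forall p : qpath Q, qsource p = qtarget p -> qarrows p = [::].

(** Number of edges between [x] and [y] in the underlying graph of [Q]. *)
Definition nb_edges (Q : quiver) (x y : vertex Q) : nat :=
  #|[set a : arrow Q | ((source a, target a) == (x, y)) ||
                       ((source a, target a) == (y, x))]|.

Definition connected (Q : quiver) : Prop :=
  forall x y : vertex Q, connect (fun u v => (0 < nb_edges u v)%N) x y.

(** The underlying (multi)graph of [Q] is the simple graph [e] on [T], up to
    isomorphism: in particular [Q] has neither loops nor multiple edges when
    [e] is irreflexive. *)
Definition underlying_graph_is (Q : quiver) (T : finType) (e : rel T) : Prop :=
  exists2 phi : vertex Q -> T, bijective phi &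
    forall x y : vertex Q, nb_edges x y = e (phi x) (phi y).

(** [D_n]: the chain [0 - 1 - ... - n-2] with [n-1] attached to [n-3]. *)
Definition dynkinD_edge (n i j : nat) : bool :=
  (((j == i.+1) && (j < n.-1)) || ((i == n - 3) && (j == n.-1)))%N.

Definition dynkinD (n : nat) : rel 'I_n :=
  fun i j => dynkinD_edge n i j || dynkinD_edge n j i.

(** [E_n]: the chain [0 - 1 - ... - n-2] with [n-1] attached to [2]. *)
Definition dynkinE_edge (n i j : nat) : bool :=
  (((j == i.+1) && (j < n.-1)) || ((i == 2) && (j == n.-1)))%N.

Definition dynkinE (n : nat) : rel 'I_n :=
  fun i j => dynkinE_edge n i j || dynkinE_edge n j i.

(* Main.v *)
From HB Require Import structures.
Require Import Defs.
From mathcomp Require Import all_boot all_order all_algebra.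
From mathcomp Require Import finmap monalg boolp.
From mathcomp Require Import ring lra zify.

(** Gabriel's theorem by reflection functors. Let [q] be the Tits form of the
    underlying graph. An indecomposable representation that is not simple at the
    sink [i] is sent by the reflection functor at [i] to an indecomposable one of
    the reflected quiver, and its dimension vector is reflected. Sweeping through
    all the vertices again and again applies powers of the Coxeter
    transformation, which cannot keep a vector nonnegative since [q] is positive
    definite. Hence the sweep ends at a simple representation, so every
    indecomposable has [q (dim M) = 1]; running the sweep backwards realizes every
    nonnegative [d] with [q d = 1]. For the Dynkin graphs at hand these [d] have
    height at most [h], attained by the highest root.

    An indecomposable of length [l <= h] is [i]-factor serial for some [i <= l]. The
    one of length [h] has a non-simple top, hence is [h]-factor serial: in a tree a
    module with simple top has a dimension vector with entries at most [1], and [h]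
    exceeds the number of vertices. Right modules are covered by working over any
    ring that looks like the path algebra of an orientation of the graph. *)

Set Implicit Arguments.
Unset Strict Implicit.
Unset Printing Implicit Defensive.
Import Order.TTheory GRing.Theory Num.Theory.
Local Open Scope quotient_scope.
Local Open Scope ring_scope.

(** * Representations of quivers *)

(** The numbers [2n - 3], [11], [17], [29] are the heights of the highest roots, each one less than
    the Coxeter number. A reflection replaces a space by a kernel, and choosing bases of kernels
    again and again would be painful. So a representation is one square matrix with an orthogonal
    idempotent per vertex; the kernel enters as the image of an idempotent in matrices of twice the
    size. This is why the idempotents may add up to less than [1]: the surplus is cut away only
    once, when a module has to be built. From then on only dimension vectors and orientations are
    remembered. An orientation is a list of vertices with arrows pointing to its front, and a
    reflection at the head moves the head to the end, so a full sweep restores the list. *)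

Section Representations.
Variables (K : fieldType) (V : finType).

Lemma mxrank_orth_idem n (F G : 'M[K]_n) :
  F *m F = F -> G *m G = G -> F *m G = 0 -> G *m F = 0 ->
  \rank (F + G)%R = (\rank F + \rank G)%N.
Proof.
move=> FF GG FG GF; rewrite -mxrank_disjoint_sum; last first.
  apply/eqP/rowV0P => x; rewrite sub_capmx => /andP[/submxP[y xy] /submxP[z xz]].
  by rewrite xy -FF mulmxA -xy xz -mulmxA GF mulmx0.
apply/eqmx_rank/andP; split; first exact: addmx_sub_adds.
rewrite addsmx_sub; apply/andP; split.
  by apply/submxP; exists F; rewrite mulmxDr FF FG addr0.
by apply/submxP; exists G; rewrite mulmxDr GG GF add0r.
Qed.

Definition orth_idem n (E : V -> 'M[K]_n) : Prop :=
  forall u v, E u *m E v = if u == v then E u else 0.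

Lemma orth_idem_suml n (E : V -> 'M[K]_n) (P : pred V) v : orth_idem E ->
  (\sum_(u | P u) E u) *m E v = if P v then E v else 0.
Proof.
move=> EE; rewrite mulmx_suml; under eq_bigr do rewrite EE.
rewrite -big_mkcondr /=; case: ifP => Pv.
  by rewrite (bigD1 v) ?Pv ?eqxx //= big1 ?addr0 // => u /andP[/andP[_ /eqP->]]; rewrite eqxx.
by rewrite big1 // => u /andP[Pu /eqP uv]; rewrite -uv Pu in Pv.
Qed.

Lemma orth_idem_sumr n (E : V -> 'M[K]_n) (P : pred V) v : orth_idem E ->
  E v *m (\sum_(u | P u) E u) = if P v then E v else 0.
Proof.
move=> EE; rewrite mulmx_sumr; under eq_bigr do rewrite EE.
rewrite -big_mkcondr /=; case: ifP => Pv.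
  by rewrite (bigD1 v) ?Pv ?eqxx //= big1 ?addr0 // => u /andP[/andP[_ /eqP->]]; rewrite eqxx.
by rewrite big1 // => u /andP[Pu /eqP uv]; rewrite uv Pu in Pv.
Qed.

Lemma orth_idem_sum_idem n (E : V -> 'M[K]_n) (P : pred V) : orth_idem E ->
  (\sum_(u | P u) E u) *m (\sum_(u | P u) E u) = \sum_(u | P u) E u.
Proof.
move=> EE; rewrite mulmx_sumr; apply: eq_bigr => v Pv.
by rewrite orth_idem_suml // Pv.
Qed.

Lemma mxrank_orth_idem_sum n (E : V -> 'M[K]_n) (P : pred V) : orth_idem E ->
  \rank (\sum_(v | P v) E v)%R = (\sum_(v | P v) \rank (E v))%N.
Proof.
move=> EE; rewrite -[X in \rank X]big_filter -[RHS]big_filter.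
have := filter_uniq P (index_enum_uniq V).
elim: [seq v <- _ | P v] => [|v s IHs].
  by rewrite !big_nil mxrank0.
rewrite cons_uniq => /andP[vs us]; rewrite !big_cons mxrank_orth_idem ?IHs //.
- by rewrite EE eqxx.
- rewrite mulmx_sumr [LHS]big_seq [RHS]big_seq; apply: eq_bigr => u us'.
  rewrite mulmx_suml (bigD1_seq u) //= EE eqxx big1_seq ?addr0 // => w /andP[wu _].
  by rewrite EE (negPf wu).
- rewrite mulmx_sumr big1_seq // => u /andP[_ us'].
  by rewrite EE; case: eqP => // vu; rewrite vu us' in vs.
- rewrite mulmx_suml big1_seq // => u /andP[_ us'].
  by rewrite EE; case: eqP => // vu; rewrite -vu us' in vs.
Qed.

(** A representation of the quiver with vertices [V] and one arrow [u -> v]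
    whenever [o u v], acting on row vectors: the space at [v] is the image of
    the idempotent [E v], and the map along [u -> v] is [E u *m A *m E v]. The
    idempotents need not add up to [1]. *)
Definition is_rep (o : rel V) n (E : V -> 'M[K]_n) (A : 'M[K]_n) : Prop :=
  [/\ orth_idem E, (\sum_v E v) *m A = A, A *m (\sum_v E v) = A &
      forall u v, ~~ o u v -> E u *m A *m E v = 0].

(** Direct summands are encoded by idempotent endomorphisms [F]; the last condition on [F] confines
    it to the part of the matrix where the representation lives. *)
Definition is_indec n (E : V -> 'M[K]_n) (A : 'M[K]_n) : Prop :=
  \sum_v E v != 0 /\
  forall F : 'M[K]_n, F *m F = F -> (forall v, F *m E v = E v *m F) ->
    F *m A = A *m F -> (\sum_v E v) *m F = F -> F = 0 \/ F = \sum_v E v.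

(** Dimension vectors take values in [int] because reflecting may produce negative entries. *)
Definition indec_dim (o : rel V) (d : V -> int) : Prop :=
  exists n (E : V -> 'M[K]_n) A,
    [/\ is_rep o E A, is_indec E A & forall v, d v = (\rank (E v))%:Z].

Definition unit_vec (i : V) : V -> int := fun v => (v == i)%:R.

Definition opp_rel (o : rel V) : rel V := fun x y => o y x.

Definition rel_reflect (o : rel V) (i : V) : rel V :=
  fun x y => if (x == i) || (y == i) then o y x else o x y.

(** [N] is a parameter: the predecessors of a sink for representations, all neighbours in the graph
    for the Tits form. *)
Definition dim_reflect (N : pred V) (i : V) (d : V -> int) : V -> int :=
  fun v => if v == i then (\sum_(j | N j) d j) - d i else d v.

Lemma indec_dim_ext o o' d d' :
  o =2 o' -> d =1 d' -> indec_dim o d -> indec_dim o' d'.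
Proof.
move=> eo dd [n [E [A [[h1 h2 h3 h4] h5 h6]]]]; exists n, E, A; split=> //.
  by split=> // u v; rewrite -eo; exact: h4.
by move=> v; rewrite -dd.
Qed.

(** Duality of vector spaces: transposing reverses the arrows and keeps the ranks. It turns sources
    into sinks, so only the reflection at a sink has to be constructed. *)
Lemma indec_dim_opp o d : indec_dim o d -> indec_dim (opp_rel o) d.
Proof.
move=> [n [E [A [[h1 h2 h3 h4] [h5 h5'] h6]]]].
have eT : \sum_v (E v)^T = (\sum_v E v)^T by rewrite raddf_sum.
have EeC v : E v *m (\sum_v E v) = (\sum_v E v) *m E v.
  by rewrite orth_idem_sumr // orth_idem_suml.
exists n, (fun v => (E v)^T), A^T; split.
- split.
  + by move=> u v; rewrite -trmx_mul h1 eq_sym; case: eqP => [->|]; rewrite ?trmx0.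
  + by rewrite eT -trmx_mul h3.
  + by rewrite eT -trmx_mul h2.
  + by move=> u v uv; rewrite -trmx_mul -trmx_mul mulmxA h4 ?trmx0.
- split; first by rewrite eT trmx_eq0.
  move=> F FF FE FA eF; rewrite eT.
  case: (h5' F^T); rewrite -?trmx_mul.
  + by rewrite FF.
  + by move=> v; have /(congr1 trmx) := FE v; rewrite !trmx_mul trmxK.
  + by have /(congr1 trmx) := FA; rewrite !trmx_mul trmxK.
  (* [is_indec] puts the sum of the idempotents on one side of [F] and transposition swaps sides;
     both agree because [F] commutes with that sum. *)
  + have cm : F *m (\sum_v E v)^T = (\sum_v E v)^T *m F.
      by rewrite -eT mulmx_sumr mulmx_suml; apply: eq_bigr => v _; rewrite FE.
    by have /(congr1 trmx) := cm; rewrite -{2}eT eF !trmx_mul trmxK.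
  + by move/(congr1 trmx); rewrite trmxK trmx0; left.
  + by move/(congr1 trmx); rewrite trmxK; right.
- by move=> v; rewrite mxrank_tr.
Qed.

Lemma indec_dim_unit o i : ~~ o i i -> indec_dim o (unit_vec i).
Proof.
move=> oi; exists 1%N, (fun v => (v == i)%:R%:M), 0.
have e1 : \sum_v (v == i)%:R%:M = 1%:M :> 'M[K]_1.
  rewrite (bigD1 i) //= eqxx big1 ?addr0 // => j /negPf ->.
  by rewrite raddf0.
split.
- split; rewrite ?mulmx0 ?mul0mx //.
  + move=> u v; rewrite -scalar_mxM; case: (eqVneq u v) => [->|uv].
      by case: (v == i); rewrite ?mulr1 ?mulr0.
    case: (eqVneq u i) => [ui|]; rewrite ?mul0r ?raddf0 //.
    by rewrite -ui eq_sym (negPf uv) mulr0 raddf0.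
  + by move=> u v _; rewrite mulmx0 mul0mx.
- rewrite /is_indec /= e1; split; first exact: oner_neq0.
  move=> F FF _ _ _; move: FF; rewrite [F]mx11_scalar -scalar_mxM.
  move/(congr1 (fun M : 'M_1 => M 0 0)); rewrite !mxE /= !mulr1n.
  move/eqP; rewrite -subr_eq0 -{3}[F 0 0]mulr1 -mulrBr mulf_eq0 subr_eq0.
  by case/orP=> /eqP->; [left; rewrite raddf0 | right].
- move=> v; rewrite /unit_vec; case: eqP => _; first by rewrite mxrank1.
  by rewrite [_%:M]raddf0 mxrank0.
Qed.

End Representations.

(** * Reflection at a sink *)

Section Reflection.
Variables (K : fieldType) (V : finType) (o : rel V) (i : V).
Variables (n : nat) (E : V -> 'M[K]_n) (A : 'M[K]_n).
Hypotheses (repA : is_rep o E A) (sink_i : forall v, ~~ o i v).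

(** Vectors are rows. [w] projects to the spaces at the predecessors of the sink, [h] is their joint
    map to the space at [i], and [g] is a generalized inverse of [h]. The idempotent [P] has as
    image the kernel of [h] inside the image of [w]; this is the new space at [i]. *)
Variables e f h g w P : 'M[K]_n.
Hypotheses (e_def : e = \sum_v E v) (f_def : f = \sum_(v | v != i) E v).
Hypotheses (h_def : h = A *m E i) (hgh : h *m g *m h = h).
Hypotheses (w_def : w = \sum_(j | o j i) E j) (P_def : P = w - h *m g *m w).

Lemma mulmx_tail m (B C D : 'M[K]_n) (X : 'M[K]_(m, n)) :
  B *m C = D -> X *m B *m C = X *m D.
Proof. by move=> <-; rewrite mulmxA. Qed.

Let EE : orth_idem E. Proof. by case: repA. Qed.
Let eA : e *m A = A. Proof. by rewrite e_def; case: repA. Qed.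
Let Ae : A *m e = A. Proof. by rewrite e_def; case: repA. Qed.
Let eE v : e *m E v = E v. Proof. by rewrite e_def orth_idem_suml. Qed.
Let Ee v : E v *m e = E v. Proof. by rewrite e_def orth_idem_sumr. Qed.
Let ee : e *m e = e. Proof. by rewrite e_def orth_idem_sum_idem. Qed.
Let EEv v : E v *m E v = E v. Proof. by rewrite EE eqxx. Qed.

Let EiA : E i *m A = 0.
Proof.
rewrite -Ae e_def mulmxA mulmx_sumr big1 // => v _.
by case: repA => _ _ _ -> //; exact: sink_i.
Qed.

Let hEi : h *m E i = h. Proof. by rewrite h_def -mulmxA EEv. Qed.
Let hA : h *m A = 0. Proof. by rewrite h_def -mulmxA EiA mulmx0. Qed.

Let wh : w *m h = h.
Proof.
have eh : e *m h = h by rewrite h_def mulmxA eA.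
rewrite -[RHS]eh e_def (bigID (fun j => o j i)) /= mulmxDl -w_def.
rewrite [X in _ + X]mulmx_suml big1 ?addr0 // => j oji.
by rewrite h_def mulmxA; case: repA => _ _ _ ->.
Qed.

Let wEi : w *m E i = 0. Proof. by rewrite w_def orth_idem_suml // (negPf (sink_i i)). Qed.
Let we : w *m e = w.
Proof. by rewrite w_def mulmx_suml; apply: eq_bigr => v _; rewrite Ee. Qed.
Let ww : w *m w = w. Proof. by rewrite w_def orth_idem_sum_idem. Qed.

Let Pw : P *m w = P. Proof. by rewrite P_def mulmxBl ww (mulmx_tail _ ww). Qed.
Let wP : w *m P = P. Proof. by rewrite P_def mulmxBr ww !mulmxA wh. Qed.
Let Ph : P *m h = 0.
Proof. by rewrite P_def mulmxBl wh (mulmx_tail _ wh) hgh subrr. Qed.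
Let PP : P *m P = P.
Proof. by rewrite {2}P_def mulmxBr Pw !mulmxA Ph !mul0mx subr0. Qed.

(** [w] is the sum of the orthogonal idempotents [P] and [h *m g *m w], and the latter has the rank
    of [h]. *)
Lemma rank_reflect :
  (\rank P + \rank h = \sum_(j | o j i) \rank (E j))%N.
Proof.
have hgw : \rank (h *m g *m w) = \rank h.
  apply/eqP; rewrite eqn_leq; apply/andP; split.
    by rewrite -mulmxA; exact: mxrankM_maxl.
  have {1}<- : h *m g *m w *m h = h by rewrite (mulmx_tail _ wh) hgh.
  exact: mxrankM_maxl.
have idem : h *m g *m w *m (h *m g *m w) = h *m g *m w.
  by rewrite !mulmxA (mulmx_tail _ wh) hgh.
rewrite -(mxrank_orth_idem_sum _ EE) -w_def -hgw -mxrank_orth_idem //.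
- by rewrite P_def subrK.
- by rewrite !mulmxA Ph !mul0mx.
- by rewrite -(mulmxA _ w) wP P_def mulmxBr !mulmxA hgh subrr.
Qed.

(** [F] projects the space at [i] along the image of [h], and it is an endomorphism because no arrow
    leaves [i]. Either [F = 0] and [h] is onto, or [F = e] and the representation lives at [i]
    alone. *)
Lemma indec_sink : is_indec E A ->
  \rank h = \rank (E i) \/ forall v, \rank (E v) = (v == i).
Proof.
rewrite /is_indec -e_def => -[e0 ind]; pose F := E i - E i *m g *m h.
have hF : h *m F = 0 by rewrite /F mulmxBr hEi !mulmxA hEi hgh subrr.
have FEi : F *m E i = F by rewrite /F mulmxBl EEv (mulmx_tail _ hEi).
have EiF : E i *m F = F by rewrite /F mulmxBr EEv !mulmxA EEv.
have EvF v : v != i -> E v *m F = 0.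
  by move=> vi; rewrite -EiF mulmxA EE (negPf vi) mul0mx.
have FEv v : v != i -> F *m E v = 0.
  by move=> vi; rewrite -FEi -mulmxA EE eq_sym (negPf vi) mulmx0.
have FA : F *m A = 0 by rewrite -FEi -mulmxA EiA mulmx0.
have AF : A *m F = 0 by rewrite -EiF mulmxA -h_def hF.
have [||||F0|Fe] := ind F.
- by rewrite {1}/F mulmxBl EiF -[_ *m h *m _]mulmxA hF mulmx0 subr0.
- by move=> v; case: (eqVneq v i) => [->|vi]; rewrite ?FEi ?EiF ?EvF ?FEv.
- by rewrite FA AF.
- by rewrite -EiF mulmxA eE.
- left; apply/eqP; rewrite eqn_leq; apply/andP; split.
    by rewrite h_def mxrankM_maxr.
  by rewrite {1}(subr0_eq F0) mxrankM_maxr.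
right=> v; case: (eqVneq v i) => [->|vi]; last first.
  by rewrite -eE -Fe (FEv _ vi) mxrank0.
have A0 : A = 0 by rewrite -Ae -Fe AF.
have eEi : e = E i.
  rewrite e_def (bigD1 i) //= big1 ?addr0 // => j ji.
  by rewrite -eE -Fe FEv.
(* Now [A = 0], so any idempotent inside [E i] is an endomorphism. A rank-one idempotent [G]
   therefore has to be all of [E i]. *)
have [r rE] : exists r, \rank (E i) = r.+1.
  case rE : (\rank (E i)) => [|r]; last by exists r.
  by move/eqP: rE; rewrite mxrank_eq0 -eEi (negPf e0).
pose C := col_base (E i); pose B := row_base (E i).
have CB : C *m B = E i := mulmx_base (E i).
have BC : B *m C = 1%:M.
  have : C *m (B *m C) *m B = C *m 1%:M *m B.
    by rewrite mulmx1 CB mulmxA CB -mulmxA CB EEv.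
  move/(row_free_inj (row_base_free _)).
  by move/(row_full_inj (col_base_full _)).
move: C B CB BC; rewrite rE => C B CB BC.
pose G := C *m delta_mx 0 0 *m B.
have GE : G *m E i = G.
  by rewrite /G -CB !mulmxA -(mulmxA _ B C) BC mulmx1.
have EG : E i *m G = G.
  by rewrite /G -CB !mulmxA -(mulmxA _ B C) BC mulmx1.
have BGC : B *m G *m C = delta_mx 0 0.
  by rewrite /G !mulmxA BC mul1mx -mulmxA BC mulmx1.
have EvG v' : v' != i -> E v' *m G = 0.
  by move=> vi; rewrite -EG mulmxA EE (negPf vi) mul0mx.
have GEv v' : v' != i -> G *m E v' = 0.
  by move=> vi; rewrite -GE -mulmxA EE eq_sym (negPf vi) mulmx0.
have [||||G0|Ge] := ind G.
- by rewrite {1 2}/G !mulmxA -(mulmxA _ B C) BC mulmx1 -(mulmxA C) mul_delta_mx.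
- by move=> v'; case: (eqVneq v' i) => [->|vi]; rewrite ?GE ?EG ?EvG ?GEv.
- by rewrite A0 mulmx0 mul0mx.
- by rewrite eEi.
- move: BGC; rewrite G0 mulmx0 mul0mx => /matrixP /(_ 0 0)/eqP.
  by rewrite !mxE /= eq_sym oner_eq0.
rewrite -rE -eEi -Ge; apply/eqP; rewrite eqn_leq; apply/andP; split.
  apply: leq_trans (mxrankM_maxl _ _) _; apply: leq_trans (mxrankM_maxr _ _) _.
  by rewrite mxrank_delta.
by rewrite lt0n mxrank_eq0 Ge.
Qed.

(** The first block keeps the other vertices, the second holds the kernel as the image of [P]. The
    entry [P] of [A'] includes the kernel into the sum of the spaces at the former predecessors:
    these are the reversed arrows. *)
Let E' (v : V) : 'M[K]_(n + n) :=
  if v == i then block_mx 0 0 0 P else block_mx (E v) 0 0 0.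
Let A' : 'M[K]_(n + n) := block_mx (A *m f) 0 P 0.

Let ef : e = E i + f. Proof. by rewrite e_def f_def (bigD1 i). Qed.
Let sumE' : \sum_v E' v = block_mx f 0 0 P.
Proof.
rewrite (bigD1 i) //= {1}/E' eqxx.
have -> : \sum_(v | v != i) E' v = block_mx f 0 0 0.
  rewrite f_def; elim/big_rec2: _ => [|v x y vi ->]; first by rewrite block_mx0.
  by rewrite /E' (negPf vi) add_block_mx !addr0.
by rewrite add_block_mx !addr0 !add0r.
Qed.

Let fEv v : v != i -> f *m E v = E v.
Proof. by move=> vi; rewrite f_def orth_idem_suml // vi. Qed.
Let fEi : f *m E i = 0.
Proof. by rewrite f_def orth_idem_suml // eqxx. Qed.
Let Eif : E i *m f = 0.
Proof. by rewrite f_def orth_idem_sumr // eqxx. Qed.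
Let ff : f *m f = f. Proof. by rewrite f_def orth_idem_sum_idem. Qed.
Let wf : w *m f = w.
Proof. by move: we; rewrite ef mulmxDr wEi add0r. Qed.
Let Pf : P *m f = P. Proof. by rewrite -Pw -mulmxA wf. Qed.
Let fA : f *m A = A. Proof. by rewrite -{2}eA ef mulmxDl EiA add0r. Qed.

Lemma reflect_is_rep : is_rep (rel_reflect o i) E' A'.
Proof.
split.
- move=> u v; rewrite /E'; case: (eqVneq u i) => ui; case: (eqVneq v i) => vi;
    rewrite mulmx_block ?(mulmx0, mul0mx, addr0, add0r) ?PP.
  + by rewrite ui vi eqxx.
  + by rewrite ui eq_sym (negPf vi) block_mx0.
  + by rewrite vi (negPf ui) block_mx0.
  + by rewrite EE; case: eqP => // _; rewrite block_mx0.
- by rewrite sumE' mulmx_block ?(mulmx0, mul0mx, addr0, add0r) PP mulmxA fA.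
- rewrite sumE' mulmx_block ?(mulmx0, mul0mx, addr0, add0r) Pf.
  by rewrite -mulmxA ff.
- move=> u v; rewrite /rel_reflect /E'.
  case: (eqVneq u i) => ui; case: (eqVneq v i) => vi //=; move=> ouv;
    rewrite !mulmx_block ?(mulmx0, mul0mx, addr0, add0r) ?block_mx0 //.
    have -> : P *m P *m E v = 0; last by rewrite block_mx0.
    by rewrite PP -Pw -mulmxA w_def orth_idem_suml // -ui (negPf ouv) mulmx0.
  rewrite mulmxA -mulmxA fEv //.
  by case: repA => _ _ _ ->; rewrite ?block_mx0.
Qed.

(** An idempotent endomorphism of the reflection has diagonal blocks [F1] and [F2 = P *m F1]. Since
    [F1] preserves the kernel of [h], it descends to the sink: lifting by [g], applying [F1] and
    mapping by [h] completes [F1] to an idempotent endomorphism [G] of the original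
    representation. *)
Lemma reflect_is_indec :
  is_indec E A -> \sum_v E' v != 0 -> is_indec E' A'.
Proof.
rewrite {1}/is_indec -e_def => -[_ ind] e'0; split=> // F' FF FE FA eF.
pose F1 := ulsubmx F'; pose F2 := drsubmx F'.
have F'E : F' = block_mx F1 0 0 F2.
  have cf : F' *m block_mx f 0 0 0 = block_mx f 0 0 0 *m F'.
    have -> : block_mx f 0 0 0 = \sum_(v | v != i) E' v.
      rewrite f_def; elim/big_rec2: _ => [|v x y vi <-]; first by rewrite block_mx0.
      by rewrite /E' (negPf vi) add_block_mx !addr0.
    by rewrite mulmx_sumr mulmx_suml; apply: eq_bigr => v _; rewrite FE.
  have cP := FE i; rewrite /E' eqxx in cP.
  move: cf cP eF; rewrite sumE' -[F']submxK -/F1 -/F2 !mulmx_block.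
  rewrite ?(mulmx0, mul0mx, addr0, add0r).
  move=> /eq_block_mx[_ ur dl _] /eq_block_mx[_ ur' dl' _] /eq_block_mx[_ fur Pdl _].
  by rewrite -fur -ur -Pdl -dl'.
move: FF FE FA eF; rewrite sumE' F'E !mulmx_block ?(mulmx0, mul0mx, addr0, add0r).
move=> /eq_block_mx[F11 _ _ F22] FE /eq_block_mx[FA1 _ FA2 _] /eq_block_mx[fF1 _ _ PF2].
have F1E v : v != i -> F1 *m E v = E v *m F1.
  move=> vi; have := FE v; rewrite /E' (negPf vi) !mulmx_block.
  by rewrite ?(mulmx0, mul0mx, addr0, add0r) => /eq_block_mx[].
have F2P : F2 *m P = P *m F2.
  have := FE i; rewrite /E' eqxx !mulmx_block.
  by rewrite ?(mulmx0, mul0mx, addr0, add0r) => /eq_block_mx[].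
have F2E : F2 = P *m F1 by rewrite -FA2 F2P.
have F1f : F1 *m f = F1.
  by rewrite -[RHS]fF1 f_def mulmx_sumr mulmx_suml; apply: eq_bigr => v /F1E.
have F1w : F1 *m w = w *m F1.
  rewrite w_def mulmx_sumr mulmx_suml; apply: eq_bigr => v ov; apply: F1E.
  by apply: contraTneq ov => ->; exact: sink_i.
have F1Ei : F1 *m E i = 0 by rewrite -F1f -mulmxA fEi mulmx0.
have EiF1 : E i *m F1 = 0 by rewrite -fF1 mulmxA Eif mul0mx.
have hF1 : h *m F1 = 0 by rewrite -hEi -mulmxA EiF1 mulmx0.
have key : h *m g *m F1 *m h = F1 *m h.
  have : P *m F1 *m h = 0.
    by rewrite -F2E -PF2 -F2P -mulmxA Ph mulmx0.
  rewrite {1}P_def !mulmxBl -F1w (mulmx_tail _ wh) -(mulmxA _ w) -F1w mulmxA.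
  by rewrite (mulmx_tail _ wh) => /eqP; rewrite subr_eq0 => /eqP.
pose G := F1 + E i *m g *m F1 *m h.
have GEi : G *m E i = E i *m g *m F1 *m h.
  by rewrite /G mulmxDl F1Ei add0r (mulmx_tail _ hEi).
have hf : h *m f = 0 by rewrite -hEi -mulmxA Eif mulmx0.
have Gf : G *m f = F1 by rewrite /G mulmxDl F1f -mulmxA hf mulmx0 addr0.
have [||||G0|Ge] := ind G.
- rewrite {2}/G mulmxDr !mulmxA GEi.
  have -> : G *m F1 = F1 by rewrite /G mulmxDl F11 (mulmx_tail _ hF1) mulmx0 addr0.
  rewrite /G; congr (_ + _).
  have -> X : X *m h *m g *m F1 *m h = X *m F1 *m h.
    by rewrite -!mulmxA (mulmxA h) (mulmxA _ F1) key.
  by rewrite (mulmx_tail _ F11).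
- move=> v; case: (eqVneq v i) => [->|vi].
    by rewrite GEi /G mulmxDr EiF1 add0r !mulmxA EEv.
  rewrite /G mulmxDl mulmxDr F1E // -(mulmxA _ h) -hEi -(mulmxA h) EE eq_sym (negPf vi).
  by rewrite !mulmx0 !mulmxA EE (negPf vi) !mul0mx.
- rewrite /G mulmxDl mulmxDr (mulmx_tail _ hA) mulmx0 addr0 !mulmxA -h_def key.
  have -> : A = A *m f + h by rewrite h_def -mulmxDr addrC -ef Ae.
  by rewrite mulmxDr FA1 mulmxDl hF1 addr0.
- rewrite /G mulmxDr !mulmxA eE ef mulmxDl EiF1 add0r fF1.
  by [].
- by left; rewrite F2E -Gf G0 mul0mx mulmx0 block_mx0.
have F1e : F1 = f by rewrite -Gf Ge ef mulmxDl Eif add0r ff.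
by right; rewrite F2E F1e Pf.
Qed.

End Reflection.

Section ReflectSink.
Variables (K : fieldType) (V : finType).

Lemma indec_dim_sink (o : rel V) (i : V) (d : V -> int) :
  (forall v, ~~ o i v) -> indec_dim K o d ->
  d =1 unit_vec i \/
  indec_dim K (rel_reflect o i) (dim_reflect (fun j => o j i) i d).
Proof.
move=> si [n [E [A [repA indA dE]]]].
have hgh : A *m E i *m pinvmx (A *m E i) *m (A *m E i) = A *m E i by exact: mulmxKpV.
have [EE _ _ _] := repA.
pose w := \sum_(j | o j i) E j.
pose P := w - (A *m E i) *m pinvmx (A *m E i) *m w.
have [rh|rE] := indec_sink repA si erefl erefl hgh indA; last first.
  by left=> v; rewrite dE rE /unit_vec; case: eqP.
have rk := rank_reflect repA erefl erefl hgh erefl (erefl P).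
have repA' := reflect_is_rep repA si erefl erefl erefl hgh erefl (erefl P).
have indA' := reflect_is_indec repA si erefl erefl erefl hgh erefl (erefl P) indA.
set E' := fun v : V => _ in repA' indA'.
(* If the reflection were zero, all spaces away from [i] would vanish, hence [h] too; as [h] has the
   rank of [E i], nothing would remain at [i] either. *)
have [e0|e0] := eqVneq (\sum_v E' v) 0; last first.
  right; do 3!eexists; split; [exact: repA'|exact: indA'|].
  move=> v; rewrite /dim_reflect /E'; case: (eqVneq v i) => [_|vi]; last first.
    by rewrite rank_diag_block_mx mxrank0 addn0 dE.
  rewrite rank_diag_block_mx mxrank0 add0n.
  apply/eqP; rewrite subr_eq; apply/eqP; rewrite dE -rh -PoszD rk.
  by rewrite (eq_bigr (fun j => (\rank (E j))%:Z)) // -[RHS]natz natr_sum; apply: eq_bigr => j _; rewrite natz.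
have E0 v : v != i -> \rank (E v) = 0%N.
  move=> vi; have [EE' _ _ _] := repA'.
  have : E' v = 0 by have := orth_idem_sumr predT v EE'; rewrite e0 mulmx0 /= => <-.
  by move/(congr1 mxrank); rewrite /E' (negPf vi) rank_diag_block_mx !mxrank0 addn0.
move: rk; rewrite big1 => [/eqP|j oji]; last by rewrite E0 //; apply: contraTneq oji => ->.
rewrite addn_eq0 rh => /andP[_ Ei0]; case: indA => /negP[].
rewrite big1 // => v _; apply/eqP; rewrite -mxrank_eq0.
by case: (eqVneq v i) => [->//|/E0 ->].
Qed.
End ReflectSink.

(** * The Tits form and Gabriel's theorem *)

Section TitsForm.
Variables (V : finType) (g : rel V).
Implicit Types (x y d : V -> int) (i j v : V) (p s t : seq V).

(** The bilinear form of the graph between [x] and the unit vector at [i], so that [refl i] is the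
    reflection in a simple root. *)
Definition cartan x i : int := x i *+ 2 - \sum_(j | g i j) x j.

(** Twice the Tits form of the graph [g]. *)
Definition tits2 x : int := \sum_i x i * cartan x i.

Definition refl i d : V -> int := dim_reflect (g i) i d.

Definition refls s d : V -> int := foldl (fun d i => refl i d) d s.

(** The orientation of [g] in which every arrow points towards the front of
    the list [p]; the head of [p] is a sink, and reflecting there rotates [p]. *)
Definition list_orient p : rel V := fun u v => g u v && (index v p < index u p)%N.

Hypotheses (g_sym : symmetric g) (g_irr : irreflexive g).

Lemma reflE i d v : refl i d v = d v - (if v == i then cartan d i else 0).
Proof.
rewrite /refl /dim_reflect /cartan; case: eqP => [->|_]; last by rewrite subr0.
ring.
Qed.

Lemma reflK i : involutive (refl i).
Proof.
move=> d; have -> : refl i (refl i d) = fun v => refl i d v + (if v == i then cartan d i else 0).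
  apply/funext => v; rewrite (reflE i (refl i d)); case: eqP => _ //.
  congr (_ + _); rewrite /cartan [X in - (_ - X)](eq_bigr d) => [|j gij]; last first.
    by rewrite reflE ifN ?subr0 //; apply: contraTneq gij => ->; rewrite g_irr.
  rewrite reflE eqxx /cartan; ring.
by apply/funext => v; rewrite reflE subrK.
Qed.

(** The expansion of the quadratic form along a simple root. With [c = cartan d i] it gives
    invariance under [refl i], and with [c = -1] at the zero vector the value [2] on simple
    roots. *)
Lemma tits2_sub_unit i d c :
  tits2 (fun v => d v - (if v == i then c else 0)) =
  tits2 d - c * cartan d i *+ 2 + c * c *+ 2.
Proof.
have cart j : cartan (fun v => d v - (if v == i then c else 0)) j =
    cartan d j - (if j == i then c *+ 2 else 0) + (if g i j then c else 0).
  rewrite /cartan sumrB -big_mkcondr /=.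
  have -> : (\sum_(k | g j k && (k == i)) c) = if g i j then c else 0.
    rewrite g_sym; case: ifP => gij.
      rewrite (big_pred1 i) // => k /=; case: eqP => [->|]; by rewrite ?gij ?andbF.
    by rewrite big_pred0 // => k; apply/andP => -[gjk /eqP ki]; rewrite -ki gjk in gij.
  case: eqP => _; ring.
rewrite /tits2 (bigD1 i) //= [in RHS](bigD1 i) //= eqxx cart eqxx g_irr.
have -> : \sum_(j | j != i) (d j - (if j == i then c else 0)) *
     cartan (fun v => d v - (if v == i then c else 0)) j =
   \sum_(j | j != i) d j * cartan d j + c * \sum_(j | g i j) d j.
  rewrite mulr_sumr [X in _ + X](big_mkcond (g i)) [X in _ + X](bigD1 i) //= g_irr add0r.
  rewrite -big_split /=; apply: eq_bigr => j /negPf ji; rewrite cart ji !subr0 mulrDr.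
  by congr (_ + _); case: ifP; rewrite ?mulr0 // mulrC.
rewrite {1 4}/cartan; set S := \sum_(j | g i j) _; set T := \sum_(j | j != i) _.
rewrite /cartan -/S; ring.
Qed.

Lemma tits2_refl i d : tits2 (refl i d) = tits2 d.
Proof.
have -> : refl i d = fun v => d v - (if v == i then cartan d i else 0).
  by apply/funext => v; rewrite reflE.
by rewrite tits2_sub_unit; ring.
Qed.

Lemma tits2_refls s d : tits2 (refls s d) = tits2 d.
Proof. by elim: s d => //= i s IHs d; rewrite IHs tits2_refl. Qed.

Lemma tits2_unit i : tits2 (unit_vec i) = 2.
Proof.
have -> : unit_vec i = fun v => 0 - (if v == i then -1 else 0).
  by apply/funext => v; rewrite /unit_vec; case: eqP.
have c0 j : cartan (fun=> 0) j = 0 by rewrite /cartan big1 // mul0rn subr0.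
rewrite (tits2_sub_unit i (fun=> 0) (-1)) c0 /tits2 big1 => [|j _]; last by rewrite mul0r.
by [].
Qed.

Lemma refls_notin s d v : v \notin s -> refls s d v = d v.
Proof.
elim: s d => //= i s IHs d; rewrite inE negb_or => /andP[vi vs].
by rewrite IHs // reflE (negPf vi) subr0.
Qed.

(** Each coordinate is changed by one reflection of [s] at most, so nothing later in the product can
    undo the effect of the first one. *)
Lemma refls_fixed s d : uniq s -> refls s d = d -> forall i, i \in s -> cartan d i = 0.
Proof.
elim: s => //= i s IHs /andP[is_ us] fx.
have ci : cartan d i = 0.
  have := congr1 (@^~ i) fx; rewrite refls_notin // reflE eqxx => /eqP.
  by rewrite addrC -subr_eq0 addrK oppr_eq0 => /eqP.
have ri : refl i d = d.
  by apply/funext => v; rewrite reflE ci if_same subr0.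
rewrite ri in fx => j; rewrite inE => /orP[/eqP->//|]; exact: IHs.
Qed.

Lemma refl_sum i (I : Type) (r : seq I) (F : I -> V -> int) :
  refl i (fun v => \sum_(k <- r) F k v) = fun v => \sum_(k <- r) refl i (F k) v.
Proof.
apply/funext => v; rewrite /refl /dim_reflect; case: eqP => _ //.
by rewrite exchange_big -sumrB.
Qed.

Lemma refls_sum s (I : Type) (r : seq I) (F : I -> V -> int) :
  refls s (fun v => \sum_(k <- r) F k v) = fun v => \sum_(k <- r) refls s (F k) v.
Proof. by elim: s F => //= i s IHs F; rewrite refl_sum IHs. Qed.

(** Positive definiteness with an explicit constant: for integer vectors it says at once that only
    zero has value zero and that vectors of bounded value are finite in number. *)
Variable C : nat.
Hypothesis tits2_bound : forall x v, `|x v| <= C%:R * tits2 x.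

Lemma tits2_eq0 x : tits2 x = 0 -> forall v, x v = 0.
Proof.
by move=> q0 v; apply/eqP; rewrite -normr_le0 (le_trans (tits2_bound x v)) // q0 mulr0.
Qed.

Lemma cartan_eq0 x : (forall i, cartan x i = 0) -> forall v, x v = 0.
Proof.
by move=> cx; apply: tits2_eq0; rewrite /tits2 big1 // => i _; rewrite cx mulr0.
Qed.

Lemma tits2_gt0 x v : x v != 0 -> 0 < tits2 x.
Proof.
move=> xv; have := tits2_bound x v; have : 0 < `|x v| by rewrite normr_gt0.
move=> h1 h2; have := lt_le_trans h1 h2.
by case: C => [|c]; rewrite ?mul0r ?ltxx // pmulr_rgt0.
Qed.

Lemma tits2_ge0 x : 0 <= tits2 x.
Proof.
have [[v /tits2_gt0/ltW//]|x0] := pselect (exists v, x v != 0).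
rewrite /tits2 big1 // => i _; case: (eqVneq (x i) 0) => [->|xi]; first by rewrite mul0r.
by case: x0; exists i.
Qed.

Lemma fin_seq_repeat (T : finType) (f : nat -> T) : exists a b, (a < b)%N /\ f a = f b.
Proof.
have /injectivePn[a [b ab fab]] : ~~ injectiveb (fun k : 'I_(#|T|.+1) => f k).
  apply/injectiveP => /leq_card; by rewrite card_ord ltnn.
case: (ltngtP a b) => [lt|gt|/ord_inj eq]; last by rewrite eq eqxx in ab.
  by exists a, b.
by exists b, a.
Qed.

(* Positive definiteness leaves finitely many vectors of bounded Tits form, so
   the Coxeter orbit of [d] repeats and the sum over a period is a fixed point
   of all the reflections. *)
Lemma coxeter_leaves_cone p d v0 : uniq p -> (forall v, v \in p) -> d v0 != 0 ->
  exists k v, iter k (refls p) d v < 0.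
Proof.
move=> up pV d0; apply: contrapT => noneg.
pose D k := iter k (refls p) d.
have D0 k v : 0 <= D k v by rewrite leNgt; apply/negP => h; apply: noneg; exists k, v.
have qD k : tits2 (D k) = tits2 d by elim: k => //= k IH; rewrite tits2_refls.
pose M := `|(C%:R * tits2 d)%R|%N.
have DM k v : (`|D k v| < M.+1)%N.
  have := tits2_bound (D k) v; rewrite qD ltnS /M; lia.
have [a [b [ab Dab]]] := fin_seq_repeat (fun k => [ffun v => Ordinal (DM k v)]).
have {}Dab : D a = D b.
  apply/funext => v; move/ffunP/(_ v): Dab; rewrite !ffunE => /(congr1 val) /=.
  have := D0 a v; have := D0 b v; lia.
pose x v := \sum_(a <= k < b) D k v.
have fx : refls p x = x.
  rewrite /x refls_sum; apply/funext => v.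
  have -> : \sum_(a <= k < b) refls p (D k) v = \sum_(a.+1 <= k < b.+1) D k v.
    by rewrite big_add1.
  by rewrite big_nat_recr //= [RHS]big_ltn // -Dab addrC.
have x0 : forall v, x v = 0.
  by apply: cartan_eq0 => i; apply: (refls_fixed up fx).
have Da0 v : D a v = 0.
  have := x0 v; rewrite /x big_ltn // => /eqP.
  by rewrite paddr_eq0 ?D0 ?sumr_ge0 // => /andP[/eqP].
have := tits2_gt0 d0; rewrite -(qD a) /tits2 big1 ?ltxx // => i _.
by rewrite Da0 mul0r.
Qed.

(** A simple reflection makes only one positive root negative. Write [refl i d] as [y] minus [m]
    times the simple root, with [y] nonnegative and zero at [i] and [m > 0]. In the expansion of its
    form all three terms are nonnegative and add up to [2], which forces [m = 1] and [y = 0]. *)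
Lemma tits2_reflect_neg i d : (forall v, 0 <= d v) -> tits2 d = 2 ->
  ~ (forall v, 0 <= refl i d v) -> d = unit_vec i.
Proof.
move=> d0 q2 neg; pose m := - refl i d i.
have m0 : 0 < m.
  rewrite oppr_gt0 ltNge; apply/negP => r0; apply: neg => v.
  case: (eqVneq v i) => [->//|vi]; by rewrite reflE (negPf vi) subr0.
pose y v := if v == i then 0 else d v.
have y0 v : 0 <= y v by rewrite /y; case: ifP.
have ry : refl i d = fun v => y v - (if v == i then m else 0).
  apply/funext => v; rewrite /y; case: (eqVneq v i) => [->|vi]; first by rewrite /m sub0r opprK.
  by rewrite reflE (negPf vi) !subr0.
have cy : cartan y i <= 0.
  rewrite /cartan /y eqxx mul0rn sub0r oppr_le0 sumr_ge0 // => j _; exact: y0.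
have qy : tits2 y - m * cartan y i *+ 2 + m * m *+ 2 = 2.
  by rewrite -tits2_sub_unit -ry tits2_refl.
have y_eq0 : tits2 y = 0.
  have := tits2_ge0 y; nia.
have yv := tits2_eq0 y_eq0.
have cy0 : cartan y i = 0 by rewrite /cartan yv big1 // mul0rn subr0.
have m1 : m = 1 by rewrite y_eq0 cy0 in qy; nia.
rewrite -[d](reflK i) ry; apply/funext => v; rewrite reflE /cartan eqxx !yv m1 /unit_vec.
rewrite big1 => [|j gij]; last first.
  by rewrite yv ifN ?subr0 //; apply: contraTneq gij => ->; rewrite g_irr.
by case: eqP => _; rewrite ?subr0.
Qed.

Section Gabriel.
Variable K : fieldType.

Lemma list_orient_sink i p v : ~~ list_orient (i :: p) i v.
Proof. by rewrite /list_orient /= eqxx ltn0 andbF. Qed.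

Lemma list_orient_in_sink i p j : list_orient (i :: p) j i = g i j.
Proof.
rewrite /list_orient /= eqxx g_sym; case: eqP => [->|_]; first by rewrite g_irr.
by rewrite andbT.
Qed.

Lemma list_orient_rcons i p : uniq (i :: p) -> (forall v, v \in i :: p) ->
  rel_reflect (list_orient (i :: p)) i =2 list_orient (rcons p i).
Proof.
move=> /= /andP[ip up] pV x y; rewrite /rel_reflect.
have ixp v : v != i -> v \in p by move=> vi; have := pV v; rewrite inE (negPf vi).
have iri : index i (rcons p i) = size p.
  by rewrite -cats1 index_cat (negPf ip) /= eqxx addn0.
have irv v : v != i -> index v (rcons p i) = index v p.
  by move=> /ixp vp; rewrite -cats1 index_cat vp.
rewrite /list_orient /=.
case: (eqVneq x i) => [->|xi]; case: (eqVneq y i) => [->|yi] /=; rewrite ?eqxx ?g_irr //.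
- by rewrite ?(eq_sym i) ?(negPf yi) g_sym iri irv // index_mem ixp.
- have xp : (size p < index x p)%N = false by rewrite ltnNge index_size.
  by rewrite ?(eq_sym i) ?(negPf xi) /= iri irv // xp ltn0 !andbF.
- by rewrite ?(eq_sym i) ?(negPf xi) ?(negPf yi) ltnS !irv.
Qed.

Lemma indec_dim_rot i p d : uniq (i :: p) -> (forall v, v \in i :: p) ->
  indec_dim K (list_orient (i :: p)) d ->
  d = unit_vec i \/ indec_dim K (list_orient (rcons p i)) (refl i d).
Proof.
move=> up pV /(indec_dim_sink (list_orient_sink i p))[du|]; [left|right].
  exact/funext.
move: b; apply: indec_dim_ext; first exact: list_orient_rcons.
move=> v; rewrite /refl /dim_reflect; congr (if _ then _ - _ else _).
by apply: eq_bigl => j; rewrite list_orient_in_sink.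
Qed.

(** After rotation [i] is a source, so the reflection is applied to the dual. The exceptional case
    of a simple representation would give [d i = -1]. *)
Lemma indec_dim_rotr i p d : uniq (i :: p) -> (forall v, v \in i :: p) ->
  (forall v, 0 <= d v) ->
  indec_dim K (list_orient (rcons p i)) (refl i d) ->
  indec_dim K (list_orient (i :: p)) d.
Proof.
move=> up pV d0 /indec_dim_opp indR.
have src v : ~~ opp_rel (list_orient (rcons p i)) i v.
  rewrite /opp_rel -(list_orient_rcons up pV) /rel_reflect eqxx orbT.
  exact: list_orient_sink.
case: (indec_dim_sink src indR) => [du|].
  have := d0 i; rewrite -[d](reflK i) (funext du) reflE eqxx /cartan big1 => [|j].
    by rewrite /unit_vec eqxx.
  by rewrite /unit_vec; case: eqP => // ->; rewrite g_irr.
move/indec_dim_opp; apply: indec_dim_ext.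
  move=> x y; rewrite /opp_rel /rel_reflect /= -!(list_orient_rcons up pV) /rel_reflect.
  by case: (x == i); case: (y == i).
move=> v; rewrite -[d in RHS](reflK i) {1}/refl /dim_reflect.
rewrite /refl /dim_reflect; congr (if _ then _ - _ else _).
apply: eq_bigl => j; rewrite /opp_rel -(list_orient_rcons up pV) /rel_reflect eqxx /=.
by rewrite list_orient_in_sink.
Qed.

(** For empty [t] this is one application of the Coxeter transformation with the orientation
    restored. The pass breaks off only at a simple representation, and reflections keep the form, so
    [d] has its value. *)
Lemma indec_dim_pass s t d : uniq (s ++ t) -> (forall v, v \in s ++ t) ->
  indec_dim K (list_orient (s ++ t)) d ->
  tits2 d = 2 \/ indec_dim K (list_orient (t ++ s)) (refls s d).
Proof.
elim: s t d => [|i s IHs] t d /= us sV; first by rewrite cats0; right.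
move=> /(indec_dim_rot us sV)[->|]; first by left; exact: tits2_unit.
rewrite rcons_cat => ind; have := IHs (rcons t i) (refl i d).
rewrite tits2_refl cat_rcons; apply => //; first by rewrite -rcons_cat rcons_uniq.
by move=> v; rewrite -rcons_cat mem_rcons.
Qed.

(** Either [refl i d] is still nonnegative and the induction goes on, or [d] is the simple root at
    [i], realized by a simple representation. Hence the end of the pass has to be realized only if
    it is nonnegative. *)
Lemma indec_dim_unpass s t d : uniq (s ++ t) -> (forall v, v \in s ++ t) ->
  (forall v, 0 <= d v) -> tits2 d = 2 ->
  ((forall v, 0 <= refls s d v) -> indec_dim K (list_orient (t ++ s)) (refls s d)) ->
  indec_dim K (list_orient (s ++ t)) d.
Proof.
elim: s t d => [|i s IHs] t d /= us sV d0 q2 ind; first by have := ind d0; rewrite cats0.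
have [r0|] := pselect (forall v, 0 <= refl i d v); last first.
  move/(tits2_reflect_neg d0 q2) ->; apply: indec_dim_unit.
  by rewrite /list_orient g_irr.
apply: indec_dim_rotr => //; rewrite rcons_cat; apply: IHs => //.
- by rewrite -rcons_cat rcons_uniq.
- by move=> v; rewrite -rcons_cat mem_rcons.
- by rewrite tits2_refl.
- by rewrite cat_rcons.
Qed.

Lemma indec_dim_ge0 (o : rel V) d : indec_dim K o d -> forall v, 0 <= d v.
Proof. by move=> [n [E [A [_ _ dE]]]] v; rewrite dE. Qed.

Lemma indec_dim_neq0 (o : rel V) d : indec_dim K o d -> exists v, d v != 0.
Proof.
move=> [n [E [A [_ [e0 _] dE]]]]; apply: contrapT => d0; case/negP: e0.
apply/eqP; rewrite big1 // => v _; apply/eqP; rewrite -mxrank_eq0; apply: contrapT.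
by move/negP => rv; apply: d0; exists v; rewrite dE.
Qed.

Lemma indec_dim_tits2 p d : uniq p -> (forall v, v \in p) ->
  indec_dim K (list_orient p) d -> tits2 d = 2.
Proof.
move=> up pV ind; apply: contrapT => q2.
have indk k : indec_dim K (list_orient p) (iter k (refls p) d).
  elim: k => //= k IH; have := @indec_dim_pass p [::] _ _ _ _ ; rewrite cats0.
  case/(_ _ up pV IH) => // q2'; case: q2; rewrite -q2'.
  by elim: k {IH q2'} => //= k ->; rewrite tits2_refls.
have [v0 d0] := indec_dim_neq0 ind.
have [k [v]] := coxeter_leaves_cone up pV d0.
by rewrite ltNge (indec_dim_ge0 (indk k)).
Qed.

Lemma tits2_indec_dim p d : uniq p -> (forall v, v \in p) ->
  (forall v, 0 <= d v) -> tits2 d = 2 -> indec_dim K (list_orient p) d.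
Proof.
move=> up pV d0 q2.
have [v0 dv0] : exists v, d v != 0.
  apply: contrapT => dn; have : tits2 d = 0; last by rewrite q2.
  rewrite /tits2 big1 // => i _; case: (eqVneq (d i) 0) => [->|di]; first by rewrite mul0r.
  by case: dn; exists i.
have [k [v]] := coxeter_leaves_cone up pV dv0; rewrite ltNge => /negP neg.
have {v neg}: ~ forall v, 0 <= iter k (refls p) d v by move=> /(_ v).
(* Induction on a number of passes after which nonnegativity fails: the vector after one pass, if
   nonnegative, needs one pass fewer. *)
elim: k d d0 q2 {v0 dv0} => [//|k IH] d d0 q2; rewrite iterSr => neg.
have := @indec_dim_unpass p [::] d; rewrite cats0; apply => // r0.
by apply: IH => //; rewrite tits2_refls.
Qed.

End Gabriel.
End TitsForm.

(** * Lattice of submodules *)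

Section QuotientLattice.
Variables (R : pzRingType) (M : lmodType R) (N : submodule M).
Implicit Types (X Y Z : submodule M) (A B : submodule (quotm N)).

Lemma pi_quotmD (x y : M) : \pi_(quotm N) (x + y) = \pi x + \pi y.
Proof. exact: (Quotient.pi_add (subm_pred N)). Qed.

Lemma eq_pi_quotm (x y : M) : (\pi_(quotm N) x == \pi y) = (x - y \in N).
Proof. by rewrite -(Quotient.idealrBE (subm_pred N)). Qed.

Lemma pi_quotm_eq0 (x : M) : (\pi_(quotm N) x == 0) = (x \in N).
Proof.
have -> : (0 : quotm N) = \pi 0 
  by apply: (addrI (\pi 0)); rewrite -pi_quotmD !addr0.
by rewrite eq_pi_quotm subr0.
Qed.

Fact quot_preim_closed A : submod_closed (fun x : M => \pi_(quotm N) x \in A).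
Proof.
split=> [|a u v].
  rewrite -[_ \in _]/(\pi_(quotm N) 0 \in A).
  by have /eqP-> : \pi_(quotm N) (0 : M) == 0; rewrite ?pi_quotm_eq0 ?rpred0.
move=> uA vA; change (\pi_(quotm N) (a *: u + v) \in A).
by rewrite pi_quotmD -pi_quotm_scale rpredD // rpredZ.
Qed.

Definition quot_preim A : submodule M := Submodule (quot_preim_closed A).

Lemma quot_preimE A x : (x \in quot_preim A) = (\pi_(quotm N) x \in A).
Proof. by []. Qed.

Lemma quot_preim_sub A B : {subset quot_preim A <= quot_preim B} <-> {subset A <= B}.
Proof.
split=> AB; last by move=> x; rewrite !quot_preimE; exact: AB.
by elim/quotW => x; rewrite -!quot_preimE; exact: AB.
Qed.

Lemma quot_preim_inj : injective quot_preim.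
Proof.
move=> A B AB; apply: submodule_eq => x.
by apply/idP/idP; move: x; apply/quot_preim_sub; rewrite AB.
Qed.

Fact quot_image_closed X : submod_closed
  (fun q : quotm N => `[< exists2 x, x \in X & q = \pi x >]).
Proof.
split=> [|a u v].
  apply/asboolP; exists 0; first exact: rpred0.
  by apply/esym/eqP; rewrite pi_quotm_eq0 rpred0.
move=> /asboolP[x xX ->] /asboolP[y yX ->]; apply/asboolP; exists (a *: x + y).
  by rewrite rpredD ?rpredZ.
by rewrite pi_quotmD -pi_quotm_scale.
Qed.

Lemma quot_preim_surj X : {subset N <= X} -> exists A, X = quot_preim A.
Proof.
move=> NX; exists (Submodule (quot_image_closed X)); apply: submodule_eq => x.
rewrite quot_preimE; apply/idP/asboolP => [xX|[y yX /eqP]]; first by exists x.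
by rewrite eq_pi_quotm => /NX xyX; rewrite -(subrK y x) rpredD.
Qed.

Lemma quot_preim_ge A : {subset N <= quot_preim A}.
Proof. by move=> x xN; rewrite quot_preimE; move: xN; rewrite -pi_quotm_eq0 => /eqP->; exact: rpred0. Qed.

Lemma quot_preim0 : quot_preim (subm0 _) = N.
Proof. by apply: submodule_eq => x; rewrite quot_preimE -pi_quotm_eq0. Qed.

Lemma quot_preimT : quot_preim (submT _) = submT M.
Proof. by apply: submodule_eq. Qed.

Lemma quot_preim_maximal A B :
  maximal_submodule (quot_preim A) (quot_preim B) <-> maximal_submodule A B.
Proof.
split=> -[sAB nAB mAB]; split.
- exact/quot_preim_sub.
- by move=> eAB; rewrite eAB in nAB.
- move=> P /quot_preim_sub AP /quot_preim_sub PB.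
  by case: (mAB _ AP PB) => /quot_preim_inj->; [left|right].
- exact/quot_preim_sub.
- by move/quot_preim_inj.
- move=> X AX XB; have [P eX] : exists P, X = quot_preim P.
    by apply: quot_preim_surj => x /(quot_preim_ge A)/AX.
  move: AX XB; rewrite eX => /quot_preim_sub AP /quot_preim_sub PB.
  by case: (mAB _ AP PB) => ->; [left|right].
Qed.

Lemma comp_series_quot A s :
  comp_series_from (quot_preim A) (map quot_preim s) <-> comp_series_from A s.
Proof.
elim: s A => [|B s IHs] A /=.
  by rewrite -quot_preimT; split=> [/quot_preim_inj|->].
by split=> -[mAB cs]; split; first [exact/quot_preim_maximal | exact/IHs].
Qed.

Lemma comp_series_from_quot X s : {subset N <= X} -> comp_series_from X s ->
  exists s', s = map quot_preim s'.
Proof.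
elim: s X => [|Y s IHs] X NX /=; first by exists [::].
move=> [[XY _ _] cs]; have NY : {subset N <= Y} by move=> x /NX/XY.
by have [[B ->] [s' ->]] := (quot_preim_surj NY, IHs _ NY cs); exists (B :: s').
Qed.

(** By the correspondence of submodules, factor seriality becomes a statement about chains in [M]
    above the terms of the radical series. *)
Lemma uniserial_quotm :
  uniserial (quotm N) <-> exists! s, comp_series_from N s.
Proof.
split=> -[s [cs us]].
  exists (map quot_preim s); split.
    by rewrite -{1}quot_preim0; apply/comp_series_quot.
  move=> t ct; have [t' et] := comp_series_from_quot (fun x => id) ct.
  rewrite et in ct *; congr map; apply: us.
  by apply/comp_series_quot; rewrite quot_preim0.
have [s' es] := comp_series_from_quot (fun x => id) cs; exists s'; split.
  by apply/comp_series_quot; rewrite quot_preim0 -es.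
move=> t' /comp_series_quot; rewrite quot_preim0 => /us; rewrite es.
exact/inj_map/quot_preim_inj.
Qed.

End QuotientLattice.

(** * Finite length, the radical series and factor seriality *)

Section FiniteLength.
Variables (R : pzRingType) (M : lmodType R) (dm : submodule M -> nat).
Implicit Types (L N X : submodule M).

Hypothesis dm_le : forall L N, {subset L <= N} -> (dm L <= dm N)%N.
Hypothesis dm_eq : forall L N, {subset L <= N} -> dm L = dm N -> L = N.
Hypothesis dm0 : dm (subm0 M) = 0%N.
(** [dm] will be the dimension over [K]. This hypothesis makes all simple factors one-dimensional,
    so that dimension and length agree. *)
Hypothesis ex_maximal : forall L N, {subset L <= N} -> L <> N ->
  exists L', [/\ {subset L <= L'}, maximal_submodule L' N & dm N = (dm L').+1].

Lemma dm_maximal L N : maximal_submodule L N -> dm N = (dm L).+1.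
Proof.
move=> [LN nLN mL]; have [L' [LL' [L'N nL'N _] dN]] := ex_maximal LN nLN.
by case: (mL _ LL' L'N) => eL; rewrite eL in dN nL'N.
Qed.

Lemma dm_comp_series N s : comp_series_from N s -> (dm N + size s)%N = dm (submT M).
Proof.
elim: s N => [|L s IHs] N /=; first by move=> ->; rewrite addn0.
by move=> [/dm_maximal dL /IHs]; rewrite dL addSnnS.
Qed.

(** Composition series can be routed through a prescribed submodule; besides existence, this later
    separates series through different maximal submodules. *)
Lemma comp_series_extend L N s : {subset L <= N} -> comp_series_from N s ->
  exists t, comp_series_from L (t ++ s) /\ last L t = N.
Proof.
have [n] := ubnP (dm N); elim: n N s => // n IHn N s; rewrite ltnS => le_n LN cs.
have [->|nLN] := pselect (L = N); first by exists [::].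
have [L' [LL' mL' dN]] := ex_maximal LN nLN.
have [||t [ct lt]] := IHn L' (N :: s) _ LL'; rewrite -?dN //.
by exists (rcons t N); rewrite cat_rcons last_rcons.
Qed.

Lemma ex_comp_series L : exists s, comp_series_from L s.
Proof.
have [//||t [ct _]] := @comp_series_extend L (submT M) [::] => //.
by exists (t ++ [::]).
Qed.

Lemma has_length_dm : has_length M (dm (submT M)).
Proof.
have [s cs] := ex_comp_series (subm0 M); exists s => //.
by rewrite -(dm_comp_series cs) dm0.
Qed.

Lemma rad_sub N : {subset Defs.rad N <= N}.
Proof. by move=> x /asboolP[]. Qed.

Lemma rad_sub_maximal L N : maximal_submodule L N -> {subset Defs.rad N <= L}.
Proof. by move=> mL x /asboolP[_]; apply. Qed.

Lemma sub0_subm N : {subset subm0 M <= N}.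
Proof. by move=> x /eqP->; exact: rpred0. Qed.

Lemma dm_rad N : N <> subm0 M -> (dm (Defs.rad N) < dm N)%N.
Proof.
move=> N0; have [L [_ mL ->]] := ex_maximal (@sub0_subm N) (nesym N0).
exact/dm_le/rad_sub_maximal.
Qed.

Local Notation l := (dm (submT M)).

Lemma dm_eq0 N : dm N = 0%N -> N = subm0 M.
Proof. by move=> N0; apply/esym/dm_eq; [exact: sub0_subm | rewrite dm0 N0]. Qed.

(** The radical series drops strictly until it reaches zero. If it is nonzero after [l - 1] steps,
    counting from the top and from the bottom shows that every step drops by exactly one. *)
Lemma dm_radn_long k : radn M l.-1 <> subm0 M -> (k <= l)%N -> dm (radn M k) = (l - k)%N.
Proof.
move=> rl0.
have radn0 j : radn M j = subm0 M -> radn M j.+1 = subm0 M.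
  by move=> r0; apply: dm_eq0; apply/eqP; rewrite -leqn0 -dm0 -r0; exact/dm_le/rad_sub.
have r0 j : (j < l)%N -> radn M j <> subm0 M.
  move=> jl rj; apply: rl0; rewrite -(subnKC (_ : j <= l.-1)%N); last by case: (l) jl.
  by elim: (l.-1 - j)%N => [|i IHi]; rewrite ?addn0 ?addnS //; exact: radn0.
have up j : (j <= l)%N -> (dm (radn M j) <= l - j)%N.
  elim: j => [|j IHj] jl; first by rewrite subn0.
  have := dm_rad (r0 j jl); have := IHj (ltnW jl); rewrite /radn iterS; lia.
have dn j : (j <= l)%N -> (j <= dm (radn M (l - j)))%N.
  elim: j => // j IHj jl.
  have lj : (l - j.+1 < l)%N by lia.
  have := dm_rad (r0 _ lj); rewrite -[Defs.rad _]/(radn M (l - j.+1).+1).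
  have -> : (l - j.+1).+1 = (l - j)%N by lia.
  have := IHj (ltnW jl); lia.
move=> kl; have := up _ kl; have := dn _ (leq_subr k l); rewrite subKn //; lia.
Qed.

(** A maximal submodule contains the radical, and here both have the same dimension. So a
    composition series has no choice but to be the radical series. *)
Lemma uniserial_long : radn M l.-1 <> subm0 M -> uniserial M.
Proof.
move=> rl0; have rE := dm_radn_long rl0.
have radE N s : comp_series_from N s -> N = radn M (size s).
  elim: s N => [|L s IHs] N //= [mN cs]; have eL := IHs _ cs.
  have dL := dm_maximal mN; have := dm_comp_series cs; rewrite dL => dl.
  apply/esym/dm_eq; first by have := rad_sub_maximal mN; rewrite {1}eL.
  rewrite -[Defs.rad _]/(radn M (size s).+1) rE; lia.
have uniq N s t : comp_series_from N s -> comp_series_from N t -> s = t.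
  elim: s t N => [|L s IHs] [|L' t] N //=.
  - move=> -> [mT _]; have := dm_maximal mT; have [h _ _] := mT.
    by have := dm_le (fun x _ => isT : x \in submT M); move=> /(_ L'); lia.
  - move=> [mT _] eT; rewrite eT in mT; have := dm_maximal mT.
    by have := dm_le (fun x _ => isT : x \in submT M); move=> /(_ L); lia.
  - move=> [mN cs] [mN' ct].
    have eLL' : L = L'.
      rewrite (radE _ _ cs) (radE _ _ ct); congr radn.
      have := dm_comp_series cs; have := dm_comp_series ct.
      rewrite (dm_maximal mN) (dm_maximal mN'); lia.
    by rewrite -eLL' in ct *; rewrite (IHs _ _ cs ct).
have [s cs] := ex_comp_series (subm0 M); exists s; split=> // t; exact: uniq.
Qed.

Lemma ex_factor_serial : nonzero_module M ->
  exists2 i, (1 <= i <= l)%N & factor_serial i M.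
Proof.
move=> [x x0].
have l0 : (0 < l)%N.
  rewrite lt0n; apply/eqP => /dm_eq0 T0.
  by move/negP: x0; apply; have : x \in submT M by []; rewrite T0.
have nz : nonzero_module M by exists x.
have [us|nus] := pselect (uniserial M); first by exists 1%N; rewrite ?l0 //; split=> //; left.
have [r0|/uniserial_long//] := pselect (radn M l.-1 = subm0 M).
have Pl : ~ uniserial (quotm (radn M l.-1)) by rewrite r0 => /uniserial_quotm.
have P0 : uniserial (quotm (radn M 0)).
  apply/uniserial_quotm; exists [::]; split=> //= -[|L s] //= [[TL nTL _] _].
  by case: nTL; apply: submodule_eq => y; apply/idP/idP => // /TL.
(* The quotient by [radn M 0] is zero and counts as uniserial, the one by [radn M l.-1 = 0] is not
   uniserial. Somewhere in between the property switches, and [i = l - k] is read off there. *)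
have [k kl [Pk nPk]] : exists2 k, (k < l.-1)%N & uniserial (quotm (radn M k)) /\
    ~ uniserial (quotm (radn M k.+1)).
  elim: (l.-1) Pl => [//|j IHj] nPj.
  have [Pj|/IHj[k kj hk]] := pselect (uniserial (quotm (radn M j))).
    by exists j.
  by exists k => //; exact: ltnW.
exists (l - k)%N; first lia.
split=> //; right; exists l; first exact: has_length_dm.
have -> : (l - (l - k) = k)%N by lia.
by rewrite addn1; split=> //; lia.
Qed.

(** For [m = l] the first quotient in the definition is zero, and the second is the top of [M],
    which has different composition series through [L1] and [L2]. *)
Lemma factor_serial_top L1 L2 :
  maximal_submodule L1 (submT M) -> maximal_submodule L2 (submT M) -> L1 <> L2 ->
  factor_serial l M.
Proof.
move=> m1 m2 n12; have l2 : (1 < l)%N.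
  rewrite (dm_maximal m1) ltnS lt0n; apply/eqP => L10; apply: n12.
  have := dm_maximal m1; rewrite (dm_maximal m2) L10 => -[L20].
  by rewrite (dm_eq0 L10) (dm_eq0 L20).
have [x [_ x0]] : exists x, x \in submT M /\ x != 0.
  apply: contrapT => all0; suff T0 : submT M = subm0 M by rewrite T0 dm0 in l2.
  apply: submodule_eq => x; apply/esym/eqP; apply: contrapT => /eqP x0.
  by apply: all0; exists x.
split; first by exists x.
right; exists l; first exact: has_length_dm.
rewrite subnn add0n; split; first by rewrite l2 leqnn.
  apply/uniserial_quotm; exists [::]; split=> //= -[|L s] //= [[TL nTL _] _].
  by case: nTL; apply: submodule_eq => y; apply/idP/idP => // /TL.
move=> /uniserial_quotm[s [_ us]].
have ext L : maximal_submodule L (submT M) -> exists2 t, s = rcons t (submT M) &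
    last (radn M 1) t = L.
  move=> mL; have [|t [ct lt]] := @comp_series_extend (radn M 1) L [:: submT M] _ (conj mL erefl).
    exact: rad_sub_maximal.
  by exists t => //; rewrite -cats1; exact: us.
have [[t1 e1 l1] [t2 e2 l2']] := (ext _ m1, ext _ m2).
by apply: n12; move: e2; rewrite e1 => /rcons_inj[e12]; rewrite -l1 -l2' e12.
Qed.

End FiniteLength.

(** * Modules as representations *)

Section MatrixModels.
Variables (K : fieldType) (V : finType) (o : rel V).

Definition matrix_model (R : pzRingType) (k : K -> R) (e : V -> R) (a : R)
    (M : lmodType R) n (E : V -> 'M[K]_n) (A : 'M[K]_n) (b : M -> 'rV[K]_n) : Prop :=
  [/\ bijective b, {morph b : x y / x + y}, forall c x, b (k c *: x) = c *: b x,
      forall v x, b (e v *: x) = b x *m E v & forall x, b (a *: x) = b x *m A].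

(** What is needed of the ring of the modules. For the path algebra, [e v] is
    the trivial path at [v] and [a] is the sum of all arrows; [e v * a * e u],
    which acts from [e u *: M] to [e v *: M], is the arrow from [u] to [v]. *)
Record quiver_ring (R : pzRingType) (k : K -> R) (e : V -> R) (a : R) : Prop :=
  QuiverRing {
  qr_scalD : {morph k : c d / c + d};
  qr_scalM : {morph k : c d / c * d};
  qr_scal1 : k 1 = 1;
  qr_scalC : forall c r, k c * r = r * k c;
  qr_orth : forall u v, e u * e v = if u == v then e u else 0;
  qr_sum : \sum_v e v = 1;
  qr_arrow : forall u v, ~~ o u v -> e v * a * e u = 0;
  qr_ind : forall P : R -> Prop, (forall x y, P x -> P y -> P (x + y)) ->
    (forall x y, P x -> P y -> P (x * y)) -> (forall c, P (k c)) ->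
    (forall v, P (e v)) -> P a -> forall r, P r;
  qr_fin : exists (T : finType) (s : T -> R), forall r, exists c : T -> K,
    r = \sum_t k (c t) * s t;
  qr_rep : forall n (E : V -> 'M[K]_n) A, is_rep o E A -> \sum_v E v = 1%:M ->
    exists (M : lmodType R) (b : M -> 'rV[K]_n), matrix_model k e a E A b }.

Variables (R : pzRingType) (k : K -> R) (e : V -> R) (a : R).
Hypothesis QR : quiver_ring k e a.

Lemma qr_scal0 : k 0 = 0.
Proof. by apply: (addrI (k 0)); rewrite -(qr_scalD QR) !addr0. Qed.

Let kN c : k (- c) = - k c.
Proof. by apply: (addrI (k c)); rewrite -(qr_scalD QR) !subrr qr_scal0. Qed.

Section Coordinates.
Variable M : lmodType R.

Definition spanning (T : finType) (f : T -> M) : Prop :=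
  forall x, exists c : T -> K, x = \sum_t k (c t) *: f t.

Lemma ex_spanning : finitely_generated M -> exists n (f : 'I_n -> M), spanning f.
Proof.
move=> [n [h hg]]; have [T [s sg]] := qr_fin QR.
pose F (t : 'I_n * T) := s t.2 *: h t.1.
exists #|{: 'I_n * T}|, (fun i => F (enum_val i)) => x.
have [c ->] := hg x; have [d dE] := choice (fun j => sg (c j)).
exists (fun i => d (enum_val i).1 (enum_val i).2).
transitivity (\sum_(t : 'I_n * T) k (d t.1 t.2) *: F t); last first.
  by rewrite -(big_enum_val (A := {: 'I_n * T}) (fun t => k (d t.1 t.2) *: F t)).
rewrite -(pair_bigA _ (fun j i => k (d j i) *: F (j, i))) /=; apply: eq_bigr => j _.
by rewrite {1}dE scaler_suml; apply: eq_bigr => i _; rewrite scalerA.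
Qed.

(** A spanning family of least size is independent, since a vector with nonzero coefficient in a
    relation could be dropped. *)
Lemma ex_basis : finitely_generated M -> exists n (f : 'I_n -> M),
  spanning f /\ forall c, \sum_i k (c i) *: f i = 0 -> forall i, c i = 0.
Proof.
move=> fg; have exP : exists n, `[< exists f : 'I_n -> M, spanning f >].
  by have [n [f sf]] := ex_spanning fg; exists n; apply/asboolP; exists f.
case: (ex_minnP exP) => n /asboolP[f sf] min; exists n, f; split=> // c c0 i0.
apply: contrapT => /eqP ci0.
case: n f sf min c c0 i0 ci0 => [|n] f sf min c c0 i0 ci0; first by case: i0 {ci0}.
have := min n; rewrite ltnn; apply/implyP/asboolP; exists (fun j => f (lift i0 j)) => x.
have [d ->] := sf x; exists (fun j => d (lift i0 j) - d i0 / c i0 * c (lift i0 j)).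
rewrite (bigD1_ord i0) //=; rewrite (bigD1_ord i0) //= in c0.
have -> : f i0 = - \sum_j k ((c i0)^-1 * c (lift i0 j)) *: f (lift i0 j).
  have /eqP := congr1 (fun x => k (c i0)^-1 *: x) c0.
  rewrite scalerDr scaler0 scalerA -(qr_scalM QR) mulVf // (qr_scal1 QR) scale1r addr_eq0.
  move/eqP=> ->; rewrite scaler_sumr; congr (- _); apply: eq_bigr => j _.
  by rewrite scalerA -(qr_scalM QR).
rewrite scalerN scaler_sumr addrC -sumrB; apply: eq_bigr => j _.
by rewrite scalerA -(qr_scalM QR) -scalerBl -kN -(qr_scalD QR) mulrA.
Qed.

Lemma ex_matrix_model : finitely_generated M ->
  exists n (E : V -> 'M[K]_n) A (b : M -> 'rV[K]_n),
    [/\ matrix_model k e a E A b, is_rep o E A & \sum_v E v = 1%:M].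
Proof.
move=> /ex_basis[n [f [sf ff]]].
have [c cE] := choice sf.
pose b x : 'rV[K]_n := \row_i c x i.
have bE x : x = \sum_i k (b x 0 i) *: f i.
  by rewrite {1}[x]cE; apply: eq_bigr => i _; rewrite mxE.
have bU x (r : 'rV[K]_n) : x = \sum_i k (r 0 i) *: f i -> b x = r.
  move=> xr; apply/rowP => i; apply/eqP; rewrite -subr_eq0; apply/eqP.
  apply: (ff (fun i => b x 0 i - r 0 i)).
  under eq_bigr do rewrite (qr_scalD QR) kN scalerBl.
  by rewrite sumrB -bE -xr subrr.
(* Acting on rows, [X] reverses products; this turns the order of factors in [qr_arrow] into the one
   in [is_rep]. *)
pose X r : 'M[K]_n := \matrix_i b (r *: f i).
have XE r i j : X r i j = b (r *: f i) 0 j by rewrite mxE.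
have bX r x : b (r *: x) = b x *m X r.
  apply: bU; rewrite {1}[x]bE scaler_sumr.
  under [RHS]eq_bigr => j _.
    rewrite mxE (big_morph k (qr_scalD QR) qr_scal0) scaler_suml.
    under eq_bigr do rewrite XE (qr_scalM QR) -scalerA.
    over.
  rewrite exchange_big /=; apply: eq_bigr => i _.
  by rewrite -scaler_sumr -bE !scalerA (qr_scalC QR).
have binv (r : 'rV[K]_n) : b (\sum_i k (r 0 i) *: f i) = r by apply: bU.
have XU r (Y : 'M[K]_n) : (forall x, b (r *: x) = b x *m Y) -> X r = Y.
  move=> rY; apply/row_matrixP => i; rewrite !rowE.
  by rewrite -[delta_mx 0 i]binv -bX rY.
have XM r s : X (r * s) = X s *m X r by apply: XU => x; rewrite -scalerA !bX mulmxA.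
have X1 : X 1 = 1%:M by apply: XU => x; rewrite scale1r mulmx1.
have bD : {morph b : x y / x + y}.
  move=> x y; apply: bU; rewrite {1}[x]bE {1}[y]bE -big_split; apply: eq_bigr => i _.
  by rewrite [(b x + b y) 0 i]mxE (qr_scalD QR) scalerDl.
have XD : {morph X : r s / r + s}.
  by move=> r s; apply: XU => x; rewrite scalerDl bD !bX mulmxDr.
have X0 : X 0 = 0 by apply: (addrI (X 0)); rewrite -XD !addr0.
have XS : \sum_v X (e v) = 1%:M by rewrite -(big_morph X XD X0) (qr_sum QR).
exists n, (fun v => X (e v)), (X a), b; split=> //.
- split=> //; last 1 first.
  + move=> d x; apply: bU; rewrite {1}[x]bE scaler_sumr; apply: eq_bigr => i _.
    by rewrite scalerA -(qr_scalM QR) [(d *: b x) 0 i]mxE.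
  exists (fun r : 'rV[K]_n => \sum_i k (r 0 i) *: f i); [by move=> x; rewrite -bE|exact: binv].
- split.
  + by move=> u v; rewrite -XM (qr_orth QR) eq_sym; case: eqP => [->|].
  + by rewrite XS mul1mx.
  + by rewrite XS mulmx1.
  + by move=> u v ouv; rewrite -!XM mulrA (qr_arrow QR ouv).
Qed.

End Coordinates.
End MatrixModels.

(** Take a matrix of maximal rank with row space inside [S]: a vector of [S] outside it would raise
    the rank. *)
Lemma ex_subspace_mx (K : fieldType) n (S : 'rV[K]_n -> Prop) :
  S 0 -> (forall c u v, S u -> S v -> S (c *: u + v)) ->
  exists B : 'M[K]_n, forall u, S u <-> (u <= B)%MS.
Proof.
move=> S0 SL; pose P r := `[< exists B : 'M[K]_n, \rank B = r /\ forall u, (u <= B)%MS -> S u >].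
have exP : exists r, P r.
  exists 0%N; apply/asboolP; exists 0; rewrite mxrank0; split=> // u.
  by rewrite submx0 => /eqP->.
have ubP r : P r -> (r <= n)%N by move=> /asboolP[B [<- _]]; exact: rank_leq_row.
case: (ex_maxnP exP ubP) => r /asboolP[B [rB BS]] max; exists B => u.
split=> [Su|]; last exact: BS.
apply: contrapT => /negP uB; pose B' := (B + u)%MS.
have : (\rank B' <= r)%N.
  apply: max; apply/asboolP; exists B'; split=> // w /sub_addsmxP[[x y] /= ->].
  rewrite addrC [y]mx11_scalar mul_scalar_mx; apply: SL => //.
  by apply: BS; exact: submxMl.
rewrite leqNgt -rB => /negP; apply; rewrite ltn_neqAle mxrankS ?addsmxSl // andbT.
apply: contra uB => /eqP rBB'.
have : (B == B')%MS by rewrite -(geq_leqif (mxrank_leqif_eq (addsmxSl B u))) rBB'.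
by move=> /andP[_]; apply: submx_trans; exact: addsmxSr.
Qed.

Lemma ex_linear_form (K : fieldType) m n (B : 'M[K]_(m, n)) (u : 'rV[K]_n) :
  ~~ (u <= B)%MS -> exists f : 'cV[K]_n, B *m f = 0 /\ u *m f = 1%:M.
Proof.
rewrite submxE; have := mulmx_coker B; move: (cokermx B) => C BC /rV0Pn[j wj].
exists (((u *m C) 0 j)^-1 *: col j C); split.
  by rewrite -scalemxAr colE mulmxA BC mul0mx scaler0.
rewrite -scalemxAr colE mulmxA -colE [col j _]mx11_scalar [col j _ 0 0]mxE scale_scalar_mx.
by rewrite mulVf.
Qed.

Section MatrixModel.
Variables (K : fieldType) (V : finType) (o : rel V).
Variables (R : pzRingType) (k : K -> R) (e : V -> R) (a : R).
Hypothesis QR : quiver_ring o k e a.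
Variables (M : lmodType R) (n : nat) (E : V -> 'M[K]_n) (A : 'M[K]_n) (b : M -> 'rV[K]_n).
Hypotheses (model : matrix_model k e a E A b) (repA : is_rep o E A).
Hypothesis sumE : \sum_v E v = 1%:M.
Implicit Types (N L X : submodule M).

Let bD : {morph b : x y / x + y}. Proof. by case: model. Qed.
Let bZ c x : b (k c *: x) = c *: b x. Proof. by case: model. Qed.
Let bE v x : b (e v *: x) = b x *m E v. Proof. by case: model. Qed.
Let bA x : b (a *: x) = b x *m A. Proof. by case: model. Qed.
Let b_inj : injective b. Proof. by case: model => /bij_inj. Qed.
Let b_surj u : exists x, b x = u.
Proof. by case: model => [[g _ gK] _ _ _ _]; exists (g u). Qed.
Let b0 : b 0 = 0. Proof. by apply: (addrI (b 0)); rewrite -bD !addr0. Qed.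
Let bN x : b (- x) = - b x.
Proof. by apply: (addrI (b x)); rewrite -bD !subrr b0. Qed.
Let b_sum I (s : seq I) (P : pred I) (F : I -> M) :
  b (\sum_(i <- s | P i) F i) = \sum_(i <- s | P i) b (F i).
Proof. exact: (big_morph b bD b0). Qed.

Let orthE : orth_idem E. Proof. by case: repA. Qed.
Let sum_e (x : M) : x = \sum_v e v *: x.
Proof. by rewrite -scaler_suml (qr_sum QR) scale1r. Qed.
Let e_idem v (x : M) : e v *: (e v *: x) = e v *: x.
Proof. by rewrite scalerA (qr_orth QR) eqxx. Qed.

Lemma submod_closed_of (S : pred M) : S 0 -> (forall x y, S x -> S y -> S (x + y)) ->
  (forall c x, S x -> S (k c *: x)) -> (forall v x, S x -> S (e v *: x)) ->
  (forall x, S x -> S (a *: x)) -> submod_closed S.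
Proof.
move=> S0 SD SZ SE SA; split=> // r x y Sx Sy; apply: (SD) Sy; move: r x Sx {y}.
apply: (qr_ind QR) => // [r s Sr Ss|r s Sr Ss] x Sx.
  by rewrite scalerDl; apply: SD; [exact: Sr|exact: Ss].
by rewrite -scalerA; apply: Sr; exact: Ss.
Qed.

Lemma ex_submodule_mx N : exists B : 'M[K]_n, forall x, (x \in N) = (b x <= B)%MS.
Proof.
have [||B BP] := @ex_subspace_mx K n (fun u => exists2 x, x \in N & u = b x).
- by exists 0; rewrite ?b0 // rpred0.
- move=> c u v [x xN ->] [y yN ->]; exists (k c *: x + y); last by rewrite bD bZ.
  by rewrite rpredD // rpredZ.
exists B => x; apply/idP/idP => [xN|]; first by apply/BP; exists x.
by move=> /BP[y yN /b_inj->].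
Qed.

Definition submodule_mx N : 'M[K]_n := sval (cid (ex_submodule_mx N)).

Lemma submodule_mxP N x : (x \in N) = (b x <= submodule_mx N)%MS.
Proof. by rewrite /submodule_mx; case: cid. Qed.

Definition submodule_dim N : nat := \rank (submodule_mx N).

Lemma submodule_mx_sub L N :
  {subset L <= N} <-> (submodule_mx L <= submodule_mx N)%MS.
Proof.
split=> [LN|LN x]; last by rewrite !submodule_mxP => /submx_trans; exact.
apply/row_subP => i; have [x bx] := b_surj (row i (submodule_mx L)).
by rewrite -bx -submodule_mxP; apply: LN; rewrite submodule_mxP bx row_sub.
Qed.

Lemma submodule_dim_le L N : {subset L <= N} -> (submodule_dim L <= submodule_dim N)%N.
Proof. by move/submodule_mx_sub/mxrankS. Qed.

Lemma submodule_dim_eq L N : {subset L <= N} -> submodule_dim L = submodule_dim N -> L = N.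
Proof.
move=> /submodule_mx_sub LN dLN; apply: submodule_eq => x; rewrite !submodule_mxP.
apply/idP/idP => [/submx_trans|]; first exact.
have : (submodule_mx L == submodule_mx N)%MS.
  by rewrite -(geq_leqif (mxrank_leqif_eq LN)) -/(submodule_dim L) dLN.
by move=> /andP[_ NL] /submx_trans; exact.
Qed.

Lemma submodule_dim_mx N (B : 'M[K]_n) :
  (forall x, (x \in N) = (b x <= B)%MS) -> submodule_dim N = \rank B.
Proof.
move=> NB; apply/eqmx_rank/andP; split; apply/row_subP => i.
  have [x bx] := b_surj (row i (submodule_mx N)).
  by rewrite -bx -NB submodule_mxP bx row_sub.
have [x bx] := b_surj (row i B).
by rewrite -bx -submodule_mxP NB bx row_sub.
Qed.

Lemma submodule_dim0 : submodule_dim (subm0 M) = 0%N.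
Proof.
rewrite (@submodule_dim_mx _ 0) ?mxrank0 // => x; rewrite submx0.
by apply/idP/eqP => [/eqP->//|]; rewrite -[RHS]b0 => /b_inj->; rewrite inE.
Qed.

Lemma submodule_dimT : submodule_dim (submT M) = n.
Proof. by rewrite (@submodule_dim_mx _ 1%:M) ?mxrank1 // => x; rewrite submx1. Qed.

(* [L'] is cut out of [N] by a linear form on [e v *: M] that vanishes on [L]
   but not at [y]. *)
Lemma ex_maximal_avoiding L N v y : {subset L <= N} ->
  y \in N -> e v *: y = y -> y \notin L ->
  (forall x, x \in N -> e v *: (a *: x) \in L) ->
  exists L', [/\ {subset L <= L'}, maximal_submodule L' N, y \notin L' &
                 submodule_dim N = (submodule_dim L').+1].
Proof.
move=> LN yN ey yL aL.
have [f [Lf yf]] := ex_linear_form (etrans (esym (congr1 negb (submodule_mxP L y))) yL).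
have Lf0 x : x \in L -> b x *m f = 0.
  by rewrite submodule_mxP => /submxP[z ->]; rewrite -mulmxA Lf mulmx0.
pose S := [pred x | (x \in N) && (b (e v *: x) *m f == 0)].
have S_closed : submod_closed S.
  apply: submod_closed_of => [|x z|c x|w x|x] /=.
  - by rewrite rpred0 scaler0 b0 mul0mx eqxx.
  - move=> /andP[xN /eqP xf] /andP[zN /eqP zf].
    by rewrite rpredD // scalerDr bD mulmxDl xf zf addr0 eqxx.
  - move=> /andP[xN /eqP xf]; rewrite rpredZ // scalerA -(qr_scalC QR) -scalerA bZ.
    by rewrite -scalemxAl xf scaler0 eqxx.
  - move=> /andP[xN /eqP xf]; rewrite rpredZ // scalerA (qr_orth QR).
    by case: (v =P w) => _; rewrite ?xf ?scale0r ?b0 ?mul0mx ?eqxx.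
  - by move=> /andP[xN _]; rewrite rpredZ // Lf0 ?eqxx //; exact: aL.
pose L' := Submodule S_closed.
have L'P x : (x \in L') = (x \in N) && (b (e v *: x) *m f == 0) by [].
have yL' : y \notin L'.
  by rewrite L'P yN ey yf /= -scalemx1 scale1r oner_eq0.
have dec x : x \in N -> exists2 z, z \in L' & exists c, x = k c *: y + z.
  move=> xN; exists (x - k ((b (e v *: x) *m f) 0 0) *: y); last first.
    by exists ((b (e v *: x) *m f) 0 0); rewrite addrC subrK.
  rewrite L'P rpredB ?rpredZ //= scalerBr scalerA -(qr_scalC QR) -scalerA ey bD bN bZ.
  by rewrite mulmxBl -scalemxAl yf scalemx1 -mx11_scalar subrr eqxx.
have L'N : {subset L' <= N} by move=> x; rewrite L'P => /andP[].
exists L'; split=> //.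
- move=> x xL; rewrite L'P LN //= Lf0 ?eqxx // rpredZ //.
- split=> [//|eL|P LP PN]; first by rewrite eL yN in yL'.
  have [PL|/existsNP[x /not_implyP[xP /negP xL]]] := pselect {subset P <= L'}.
    by left; apply: submodule_eq => x; apply/idP/idP => [/PL|/LP].
  right; have [z zL [c ex]] := dec x (PN _ xP).
  have c0 : c != 0.
    by apply: contraNneq xL => c0; rewrite ex c0 (qr_scal0 QR) scale0r add0r.
  have yP : y \in P.
    rewrite -[y]scale1r -(qr_scal1 QR) -(mulVf c0) (qr_scalM QR) -scalerA rpredZ //.
    by rewrite -(addrK z (k c *: y)) -ex rpredB // LP.
  apply: submodule_eq => x'; apply/idP/idP => [/PN//|/dec[z' z'L [c' ->]]].
  by rewrite rpredD ?rpredZ // LP.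
- have le : (submodule_dim N <= (submodule_dim L').+1)%N.
    have : (submodule_mx N <= submodule_mx L' + b y)%MS.
      apply/row_subP => i; have [x bx] := b_surj (row i (submodule_mx N)).
      have /dec[z zL [c ex]] : x \in N by rewrite submodule_mxP bx row_sub.
      rewrite -bx ex bD bZ addrC; apply: addmx_sub_adds; first by rewrite -submodule_mxP.
      exact: scalemx_sub.
    move/mxrankS/leq_trans; apply; rewrite (leq_trans (mxrank_adds_leqif _ _)) //.
    by rewrite -[X in (_ <= X)%N]addn1 leq_add2l rank_leq_row.
  apply/eqP; rewrite eqn_leq le ltn_neqAle submodule_dim_le // andbT.
  by apply: contra yL' => /eqP/(submodule_dim_eq L'N)->.
Qed.

Variable rk : V -> nat.
Hypothesis rkP : forall u v, o u v -> (rk v < rk u)%N.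

(** Among the vertices where [N] exceeds [L], take [v] of largest [rk]. Arrows into [v] start at
    vertices of larger [rk], where [N] already lies in [L], so they land in [L]. *)
Lemma ex_maximal_over L N : {subset L <= N} -> L <> N ->
  exists L', [/\ {subset L <= L'}, maximal_submodule L' N &
                 submodule_dim N = (submodule_dim L').+1].
Proof.
move=> LN nLN.
pose P v := `[< exists2 x, x \in N & e v *: x \notin L >].
have [v0 Pv0] : exists v, P v.
  apply: contrapT => noP; apply: nLN; apply: submodule_eq => x.
  apply/idP/idP => [/LN//|xN]; rewrite [x]sum_e rpred_sum // => v _.
  by apply: contrapT => /negP exL; apply: noP; exists v; apply/asboolP; exists x.
case: (@arg_maxnP _ v0 P rk Pv0) => v /asboolP[x xN xL] vmax.
have [||||L' [LL' mL' _ dL']] := @ex_maximal_avoiding L N v (e v *: x) LN.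
- exact: rpredZ.
- exact: e_idem.
- exact: xL.
- move=> z zN; rewrite [z]sum_e !scaler_sumr rpred_sum // => u _.
  rewrite !scalerA; have [ouv|nouv] := boolP (o u v); last first.
    by rewrite ?mulrA (qr_arrow QR nouv) scale0r rpred0.
  rewrite -!scalerA; do 2!apply: rpredZ; apply: contrapT => /negP ezL.
  have /vmax : P u by apply/asboolP; exists z.
  by move=> /leq_ltn_trans/(_ (rkP ouv)); rewrite ltnn.
- by exists L'.
Qed.

Lemma model_factor_serial : nonzero_module M ->
  exists2 i, (1 <= i <= n)%N & factor_serial i M.
Proof.
have := ex_factor_serial submodule_dim_le submodule_dim_eq submodule_dim0 ex_maximal_over.
by rewrite submodule_dimT.
Qed.

(* The images of the arrows span a graded submodule, above which every
   homogeneous vector is avoided by some maximal submodule. *)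
Lemma model_factor_serial_top :
  (\sum_v \rank (A *m E v) + 1 < n)%N -> factor_serial n M.
Proof.
move=> rkA; pose B := (\sum_v <<A *m E v>>)%MS.
have rkB : (\rank B + 1 < n)%N.
  apply: leq_ltn_trans rkA; rewrite leq_add2r.
  apply: leq_trans (mxrank_sum_leqif _) _ => /=.
  by apply: leq_sum => v _; rewrite mxrank_gen.
have bAB x : (b (a *: x) <= B)%MS.
  rewrite [a *: x]sum_e b_sum summx_sub // => v _.
  by rewrite bE bA -mulmxA (sumsmx_sup v) // genmxE submxMl.
have X_closed : submod_closed [pred x | (b x <= B)%MS].
  apply: submod_closed_of => [|x y|c x|v x|x] /=.
  - by rewrite b0 sub0mx.
  - by rewrite bD; exact: addmx_sub.
  - by rewrite bZ; exact: scalemx_sub.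
  - move=> xB; rewrite bE; apply: submx_trans (submxMr _ xB) _.
    rewrite sumsmxMr; apply/sumsmx_subP => w _.
    rewrite (eqmxMr _ (genmxE _)) -mulmxA orthE; case: eqP => _; last by rewrite mulmx0 sub0mx.
    by rewrite (sumsmx_sup w) // genmxE.
  - by rewrite bAB.
pose X := Submodule X_closed.
have XP x : (x \in X) = (b x <= B)%MS by [].
have dX : submodule_dim X = \rank B by apply: submodule_dim_mx.
have hom (Y : submodule M) : {subset X <= Y} -> (\rank B < submodule_dim Y)%N ->
    exists (v : V) (y : M), [/\ y \in Y, e v *: y = y & y \notin X].
  move=> XY dY; apply: contrapT => noy.
  have : Y = X.
    apply: submodule_eq => x; apply/idP/idP => [xY|/XY//].
    rewrite [x]sum_e rpred_sum // => v _; apply: contrapT => /negP exX.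
    by apply: noy; exists v, (e v *: x); rewrite rpredZ // e_idem.
  by move=> eY; rewrite eY dX ltnn in dY.
have avoid v (y : M) : e v *: y = y -> y \notin X ->
    exists L, [/\ {subset X <= L}, maximal_submodule L (submT M), y \notin L & n = (submodule_dim L).+1].
  move=> ey yX; have [||||//|L hL] := @ex_maximal_avoiding X (submT M) v y => //.
    by move=> x _; rewrite rpredZ // XP.
  by exists L; rewrite submodule_dimT in hL.
have [//||v [y [_ ey yX]]] := hom (submT M); first by rewrite submodule_dimT; lia.
have [L1 [XL1 mL1 _ dL1]] := avoid v y ey yX.
have [//||v' [y' [y'L1 ey' y'X]]] := hom L1; first by lia.
have [L2 [_ mL2 y'L2 _]] := avoid v' y' ey' y'X.
have := factor_serial_top submodule_dim_eq submodule_dim0 ex_maximal_over mL1 mL2.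
rewrite submodule_dimT; apply => e12; by rewrite -e12 y'L1 in y'L2.
Qed.

(** An idempotent endomorphism [F] splits [M] into the kernels of [1 - F] and [F]. *)
Lemma model_is_indec : indecomposable M -> is_indec E A.
Proof.
move=> [[x0 x00] ind]; split.
  rewrite sumE; apply: contraNneq x00 => e0; apply/eqP/b_inj.
  by rewrite -[b x0]mulmx1 e0 mulmx0 b0.
rewrite sumE => F FF FE FA _.
have closed (G : 'M[K]_n) : (forall v, G *m E v = E v *m G) -> G *m A = A *m G ->
    submod_closed [pred x | b x *m G == 0].
  move=> GE GA; apply: submod_closed_of => [|x y|c x|v x|x] /=.
  - by rewrite b0 mul0mx.
  - by rewrite bD mulmxDl => /eqP-> /eqP->; rewrite addr0.
  - by rewrite bZ -scalemxAl => /eqP->; rewrite scaler0.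
  - by rewrite bE -mulmxA -GE mulmxA => /eqP->; rewrite mul0mx.
  - by rewrite bA -mulmxA -GA mulmxA => /eqP->; rewrite mul0mx.
pose F' := 1%:M - F.
have FF' : F *m F' = 0 by rewrite mulmxBr mulmx1 FF subrr.
have F'F : F' *m F = 0 by rewrite mulmxBl mul1mx FF subrr.
have ker0 (G H : 'M[K]_n) (cH : submod_closed [pred x | b x *m H == 0]) :
    G *m H = 0 -> Submodule cH = subm0 M -> G = 0.
  move=> GH H0; apply/row_matrixP => i; rewrite row0.
  have [x bx] := b_surj (row i G).
  have : x \in Submodule cH by apply/eqP; rewrite bx -row_mul GH row0.
  by rewrite H0 => /eqP x0'; rewrite -bx x0' b0.
have cF := closed F FE FA.
have [||cF'] := closed F'.
- by move=> v; rewrite mulmxBl mulmxBr FE mul1mx mulmx1.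
- by rewrite mulmxBl mulmxBr FA mul1mx mulmx1.
move=> cl; have {cF' cl}cF' := conj cF' cl; have [||z0|z0] := ind (Submodule cF') (Submodule cF).
- move=> x; have [y by_] := b_surj (b x *m F); have [z bz] := b_surj (b x *m F').
  exists y, z; split; first by apply/eqP; rewrite by_ -mulmxA FF' mulmx0.
    by apply/eqP; rewrite bz -mulmxA F'F mulmx0.
  by apply: b_inj; rewrite bD by_ bz -mulmxDr /F' addrC subrK mulmx1.
- move=> x /eqP xF' /eqP xF; apply: b_inj.
  by rewrite b0 -[b x]mulmx1 -(subrK F 1%:M) mulmxDr xF xF' addr0.
- by left; apply: ker0 FF' z0.
- by right; apply/esym/eqP; rewrite -subr_eq0; apply/eqP; apply: ker0 F'F z0.
Qed.

(** The projection to [X] along [Y] commutes with the whole ring, hence is an idempotent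
    endomorphism. *)
Lemma model_indecomposable : is_indec E A -> indecomposable M.
Proof.
rewrite /is_indec sumE => -[e0 ind]; split.
  have /rowV0Pn[u _ u0] := e0; have [x bx] := b_surj u; exists x.
  by apply: contraNneq u0 => x0; rewrite -bx x0 b0.
move=> X Y XY XY0.
pose BX := submodule_mx X; pose BY := submodule_mx Y.
have cap0 : (BX :&: BY = 0)%MS.
  apply/eqP/rowV0P => u; rewrite sub_capmx => /andP[uX uY].
  have [x bx] := b_surj u; rewrite -bx -!submodule_mxP in uX uY *.
  by rewrite (XY0 _ uX uY) b0.
have [F Fadd] : exists F : 'M[K]_n, forall x y, x \in X -> y \in Y -> b (x + y) *m F = b x.
  exists (proj_mx BX BY) => x y; rewrite !submodule_mxP => xX yY.
  by rewrite bD mulmxDl proj_mx_id // proj_mx_0 // addr0.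
have Fcomm (r : R) (G : 'M[K]_n) : (forall x, b (r *: x) = b x *m G) -> F *m G = G *m F.
  move=> rG; apply/row_matrixP => i; rewrite !rowE.
  have [x <-] := b_surj (delta_mx 0 i); have [y [z [yX zY ->]]] := XY x.
  by rewrite !mulmxA -rG Fadd // scalerDr Fadd ?rpredZ // -rG.
have [||||F0|F1] := ind F.
- apply/row_matrixP => i; rewrite !rowE.
  have [x <-] := b_surj (delta_mx 0 i); have [y [z [yX zY ->]]] := XY x.
  by rewrite mulmxA Fadd // -[in LHS](addr0 y) Fadd // rpred0.
- by move=> v; apply: (Fcomm (e v)) => x; rewrite bE.
- by apply: (Fcomm a) => x; rewrite bA.
- by rewrite mul1mx.
- left; apply: submodule_eq => x; apply/idP/eqP => [xX|->]; last exact: rpred0.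
  by apply: b_inj; rewrite -(Fadd x 0) ?rpred0 // F0 mulmx0 b0.
- right; apply: submodule_eq => x; apply/idP/eqP => [xY|->]; last exact: rpred0.
  by apply: b_inj; rewrite -(mulmx1 (b x)) -F1 -[x]add0r Fadd ?rpred0.
Qed.

Lemma model_finitely_generated : finitely_generated M.
Proof.
pose g i := sval (cid (b_surj (delta_mx 0 i))).
have bg i : b (g i) = delta_mx 0 i by rewrite /g; case: cid.
exists n, g => x; exists (fun i => k (b x 0 i)); apply: b_inj.
by rewrite b_sum {1}[b x]row_sum_delta; apply: eq_bigr => i _; rewrite bZ bg.
Qed.

End MatrixModel.

Section FullRepresentation.
Variables (K : fieldType) (V : finType).

(** A module needs idempotents with sum [1]. Factor their sum as [e = C *m B] with [B *m C = 1] and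
    replace each [X] by [B *m X *m C], which is multiplicative on the corner cut out by [e]. *)
Lemma indec_dim_full (o : rel V) (d : V -> int) : indec_dim K o d ->
  exists n (E : V -> 'M[K]_n) A,
    [/\ is_rep o E A, is_indec E A, \sum_v E v = 1%:M & forall v, d v = (\rank (E v))%:Z].
Proof.
move=> [n [E [A [[EE eA Ae arr] [e0 ind] dE]]]].
move: eA Ae e0 ind; set e := \sum_v E v => eA Ae e0 ind.
have ee : e *m e = e by exact: orth_idem_sum_idem.
have eE v : e *m E v = E v by rewrite /e orth_idem_suml.
have Ee v : E v *m e = E v by rewrite /e orth_idem_sumr.
have [r [C [B [CB BC]]]] : exists r (C : 'M[K]_(n, r)) (B : 'M[K]_(r, n)),
    C *m B = e /\ B *m C = 1%:M.
  exists (\rank e), (col_base e), (row_base e); split; first exact: mulmx_base.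
  have : col_base e *m (row_base e *m col_base e) *m row_base e =
         col_base e *m 1%:M *m row_base e.
    by rewrite mulmx1 mulmx_base mulmxA mulmx_base -mulmxA mulmx_base.
  move/(row_free_inj (row_base_free _)).
  by move/(row_full_inj (col_base_full _)).
have Be : B *m e = B by rewrite -CB mulmxA BC mul1mx.
have eC : e *m C = C by rewrite -CB -mulmxA BC mulmx1.
pose E' v := B *m E v *m C; pose A' := B *m A *m C.
have sandwich (X Y : 'M[K]_n) : X *m e = X -> B *m X *m C *m (B *m Y *m C) = B *m (X *m Y) *m C.
  by move=> Xe; rewrite !mulmxA -(mulmxA _ C B) CB -(mulmxA B X) Xe.
have sumE' : \sum_v E' v = 1%:M.
  by rewrite /E' -mulmx_suml -mulmx_sumr -/e Be BC.
have lift (X : 'M[K]_n) : e *m X = X -> X *m e = X -> C *m (B *m X *m C) *m B = X.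
  by move=> eX Xe; rewrite !mulmxA CB eX -mulmxA CB.
exists r, E', A'; split=> //.
- split; rewrite ?sumE' ?mul1mx ?mulmx1 //.
  + move=> u v; rewrite /E' sandwich ?Ee // EE.
    by case: eqP => [->|_]; rewrite ?mulmx0 ?mul0mx.
  + move=> u v ouv; rewrite /E' /A' sandwich ?Ee // sandwich; last by rewrite -mulmxA Ae.
    by rewrite arr // mulmx0 mul0mx.
- rewrite /is_indec sumE'; split.
    apply: contraNneq e0 => r0.
    by rewrite -(lift e) // Be BC r0 mulmx0 mul0mx.
  move=> F FF FE FA _; pose F1 := C *m F *m B.
  have inv : B *m F1 *m C = F.
    by rewrite /F1 !mulmxA BC mul1mx -mulmxA BC mulmx1.
  have comm (X : 'M[K]_n) : e *m X = X -> X *m e = X ->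
      F *m (B *m X *m C) = B *m X *m C *m F -> F1 *m X = X *m F1.
    move=> eX Xe FX; rewrite -[X in F1 *m X](lift X) // -[X in X *m F1](lift X) //.
    move: FX; move: (B *m X *m C) => Y FY.
    rewrite /F1 !mulmxA -(mulmxA (C *m F)) BC mulmx1 -(mulmxA (C *m Y)) BC mulmx1.
    by rewrite -!(mulmxA C) FY.
  have [|||||] := ind F1.
  + by rewrite /F1 !mulmxA -(mulmxA _ B C) BC mulmx1 -(mulmxA C) FF.
  + by move=> v; apply: comm; rewrite ?eE ?Ee //; exact: FE.
  + exact: comm.
  + by rewrite /F1 !mulmxA eC.
  + by move=> F0; left; rewrite -inv F0 mulmx0 mul0mx.
  + by move=> F1e; right; rewrite -inv F1e Be BC.
- move=> v; rewrite dE; congr Posz; apply/eqP; rewrite eqn_leq; apply/andP; split.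
    rewrite -{1}(lift (E v)) //.
    exact: leq_trans (mxrankM_maxl _ _) (mxrankM_maxr _ _).
  exact: leq_trans (mxrankM_maxl _ _) (mxrankM_maxr _ _).
Qed.

End FullRepresentation.

(** * From heights of roots to the Nakayama property *)

Section NakayamaBound.
Variables (V : finType) (g : rel V) (C : nat).
Hypotheses (g_sym : symmetric g) (g_irr : irreflexive g).
Hypothesis tits2_bound : forall x v, `|x v| <= C%:R * tits2 g x.
Variable p : seq V.
Hypotheses (p_uniq : uniq p) (pV : forall v, v \in p).
Local Notation o := (list_orient g p).

Let rk v := index v p.

Let orientE u v : g u v = (o u v + o v u)%N :> nat.
Proof.
rewrite /list_orient [g v u]g_sym; case: ltngtP => uv; rewrite ?andbT ?andbF ?addn0 //.
suff -> : u = v by rewrite g_irr.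
by rewrite -(nth_index u (pV u)) -(nth_index u (pV v)) uv.
Qed.

(* By positive definiteness the arrows inside the support of [d] form a forest;
   as at most one vertex of the support fails [d v <= \sum_(u -> v) d u], each
   other vertex has exactly one predecessor there, whence [d <= 1]. *)
Lemma simple_top_bound (d : V -> nat) (r : V -> nat) :
  (forall v, r v <= d v)%N -> (forall v, r v <= \sum_(u | o u v) d u)%N ->
  (\sum_v d v <= \sum_v r v + 1)%N -> (\sum_v d v <= #|V|)%N.
Proof.
move=> rd ro dr.
case: (pickP (fun v => 0 < d v)%N) => [v1 dv1|d0]; last first.
  by rewrite big1 // => v _; have := d0 v; rewrite lt0n => /negbFE/eqP.
(* [v0] is a source of the support, so [r v0 = 0]. As the total of [d] exceeds that of [r] by at
   most one, the whole difference sits at [v0]. *)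
case: (@arg_maxnP _ v1 (fun v => 0 < d v)%N rk dv1) => v0 dv0 max0.
have in0 u : o u v0 -> d u = 0%N.
  move=> /andP[_ uv]; apply/eqP; rewrite -leqn0 leqNgt; apply/negP => /max0 h.
  by have := leq_ltn_trans h uv; rewrite ltnn.
have r0 : r v0 = 0%N by apply/eqP; rewrite -leqn0; have := ro v0; rewrite big1.
have drv v : v != v0 -> d v = r v /\ d v0 = 1%N.
  move=> vv0; have : (\sum_(w | w != v0) r w <= \sum_(w | w != v0) d w)%N by apply: leq_sum.
  move: dr; rewrite (bigD1 v0) //= [in X in (_ <= X)%N](bigD1 v0) //= r0 add0n.
  rewrite (bigD1 v) //= [in X in (_ <= X)%N](bigD1 v) //=.
  have : (\sum_(w | (w != v0) && (w != v)) r w <= \sum_(w | (w != v0) && (w != v)) d w)%N.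
    by apply: leq_sum.
  have := rd v; lia.
have dv01 : d v0 = 1%N.
  have : (\sum_(w | w != v0) r w <= \sum_(w | w != v0) d w)%N by apply: leq_sum.
  move: dr; rewrite (bigD1 v0) //= [in X in (_ <= X)%N](bigD1 v0) //= r0; lia.
pose c v : nat := (0 < d v)%N.
pose indeg v := (\sum_(u | o u v) c u)%N.
(* On the indicator of the support the Tits form counts vertices minus arrows. *)
have tits_c : tits2 g (fun v => (c v)%:Z) =
    2 * ((\sum_v c v)%N%:Z - (\sum_v c v * indeg v)%N%:Z).
  have dbl : (\sum_v c v * \sum_(u | g v u) c u = 2 * \sum_v c v * indeg v)%N.
    transitivity (\sum_v \sum_u (c v * c u * o v u + c v * c u * o u v))%N.
      apply: eq_bigr => v _; rewrite big_mkcond big_distrr; apply: eq_bigr => u _.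
      by rewrite -mulnDr -orientE; case: (g v u); rewrite /= ?muln1 ?muln0.
    under eq_bigr do rewrite big_split /=.
    rewrite big_split /= exchange_big /= mul2n -addnn.
    congr (_ + _)%N; apply: eq_bigr => v _; rewrite /indeg [in RHS]big_mkcond big_distrr;
      apply: eq_bigr => u _.
      by rewrite [(c u * c v)%N]mulnC; case: (o u v); rewrite /= ?muln1 ?muln0.
    by case: (o u v); rewrite /= ?muln1 ?muln0.
  rewrite mulrBr -!PoszM -dbl mul2n -addnn PoszD !(big_morph Posz PoszD (erefl _)).
  rewrite -big_split -sumrB; apply: eq_bigr => v _; rewrite /cartan PoszM.
  rewrite (big_morph Posz PoszD (erefl _)) mulrBr; congr (_ - _).
  by rewrite /c; case: (0 < d v)%N.
have indeg_le : (\sum_v c v * indeg v + 1 <= \sum_v c v)%N.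
  have : 0 < tits2 g (fun v => (c v)%:Z).
    by apply: (tits2_gt0 tits2_bound (v := v0)); rewrite /c dv0.
  rewrite tits_c; lia.
have indeg_ge v : v != v0 -> (0 < d v)%N -> (1 <= indeg v)%N.
  move=> vv0 dv; rewrite lt0n; apply/eqP => /eqP; rewrite sum_nat_eq0 => /forallP ind0.
  have [drv_ _] := drv v vv0; move: dv; rewrite drv_ => /leq_trans/(_ (ro v)).
  rewrite big1 // => u ouv; apply/eqP; rewrite -leqn0 leqNgt; apply/negP => du.
  by have := ind0 u; rewrite ouv /c du.
have indeg1 v : v != v0 -> (0 < d v)%N -> indeg v = 1%N.
  move=> vv0 dv; have le w : w != v0 -> (c w <= c w * indeg w)%N.
    by move=> ww0; rewrite /c; case: (posnP (d w)) => // /(indeg_ge w ww0); rewrite mul1n.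
  have cv0 : c v0 = 1%N by rewrite /c dv0.
  have cv : c v = 1%N by rewrite /c dv.
  have := indeg_le; rewrite (bigD1 v0) //= [in X in (_ <= X)%N](bigD1 v0) //=.
  rewrite (bigD1 v) //= [in X in (_ <= X)%N](bigD1 v) //= cv0 cv !mul1n.
  have : (\sum_(w | (w != v0) && (w != v)) c w <=
          \sum_(w | (w != v0) && (w != v)) c w * indeg w)%N.
    by apply: leq_sum => w /andP[ww0 _]; exact: le.
  have := indeg_ge v vv0 dv; lia.
have d1 v : (d v <= 1)%N.
  have [m] := ubnP (size p - rk v); elim: m v => // m IHm v mv.
  case: (eqVneq v v0) => [->|vv0]; first by rewrite dv01.
  case: (posnP (d v)) => [->//|dv]; rewrite -(indeg1 v vv0 dv).
  have [-> _] := drv v vv0; apply: leq_trans (ro v) _.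
  apply: leq_sum => u ouv; case: (posnP (d u)) => [->//|du].
  rewrite /c du; apply: IHm; move: ouv => /andP[_ ouv].
  have : (index u p < size p)%N by rewrite index_mem.
  rewrite /rk in mv *; lia.
by apply: leq_trans (leq_sum _ (fun v _ => d1 v)) _; rewrite sum1_card.
Qed.

Variables (K : fieldType) (R : pzRingType) (k : K -> R) (e : V -> R) (a : R).
Hypothesis QR : quiver_ring o k e a.

Let rkP u v : o u v -> (rk v < rk u)%N. Proof. by case/andP. Qed.

Lemma left_nakayama_height (h : nat) (theta : V -> int) :
  (#|V| < h)%N ->
  (forall x, (forall v, 0 <= x v) -> tits2 g x = 2 -> \sum_v x v <= h%:Z) ->
  (forall v, 0 <= theta v) -> tits2 g theta = 2 -> \sum_v theta v = h%:Z ->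
  left_nakayama R h.
Proof.
move=> Vh bound th0 th2 thh; split.
  move=> M fgM indM; have [n [E [A [b [model repA sumE]]]]] := ex_matrix_model QR fgM.
  have indA := model_is_indec QR model sumE indM.
  have indd : indec_dim K o (fun v => (\rank (E v))%:Z) by exists n, E, A.
  have q2 := indec_dim_tits2 g_sym g_irr tits2_bound p_uniq pV indd.
  have [EE _ _ _] := repA.
  have nh : (n <= h)%N.
    have := bound _ (fun v => le0z_nat _) q2.
    by rewrite -(big_morph Posz PoszD (erefl _)) -(mxrank_orth_idem_sum predT EE) sumE mxrank1.
  have [i /andP[i1 i_n] fi] := model_factor_serial QR model rkP (proj1 indM).
  by exists i; rewrite ?i1 ?(leq_trans i_n nh).
have [n [E [A [repA indA sumE dE]]]] :=
  indec_dim_full (tits2_indec_dim g_sym g_irr tits2_bound K p_uniq pV th0 th2).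
have [M [b model]] := qr_rep QR repA sumE.
have [EE eA Ae arr] := repA.
have nE : (\sum_v \rank (E v))%N = n.
  by rewrite -(mxrank_orth_idem_sum predT EE) sumE mxrank1.
have nh : n = h.
  apply/eqP; rewrite -eqz_nat -thh -nE (big_morph Posz PoszD (erefl _)).
  by apply/eqP; apply: eq_bigr => v _; rewrite dE.
exists M; split.
- exact: (model_finitely_generated model).
- exact: (model_indecomposable model sumE).
rewrite -nh; apply: (model_factor_serial_top QR model repA rkP).
rewrite ltnNge; apply/negP => le.
suff : (\sum_v \rank (E v) <= #|V|)%N by rewrite nE nh leqNgt Vh.
(* Here [r v] is the dimension at [v] of the span of the images of all arrows. It is at most that of
   the space at [v] and that of its predecessors together. *)
apply: (@simple_top_bound _ (fun v => \rank (A *m E v))).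
- by move=> v; exact: mxrankM_maxr.
- move=> v; rewrite -(mxrank_orth_idem_sum _ EE).
  have -> : A *m E v = (\sum_(u | o u v) E u) *m (A *m E v).
    rewrite -[A in LHS]eA (bigID (fun u => o u v)) /= !mulmxDl -!mulmxA.
    rewrite [X in _ + X](_ : _ = 0) ?addr0 // mulmx_suml big1 // => u ouv.
    by rewrite mulmxA arr.
  exact: mxrankM_maxl.
- by rewrite nE; apply: leq_trans le _.
Qed.

End NakayamaBound.

(** * The path algebra *)

Section MatrixModule.
Variables (K : fieldType) (R : pzRingType) (n : nat) (Phi : R -> 'M[K]_n).
Hypotheses (PhiD : {morph Phi : r s / r + s}) (Phi1 : Phi 1 = 1%:M).
Hypothesis PhiM : forall r s, Phi (r * s) = Phi s *m Phi r.

(** [Phi] is part of the type so that the module structure can be inferred from it. *)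
Definition matrix_module of (R -> 'M[K]_n) : Type := 'rV[K]_n.
Local Notation M := (matrix_module Phi).

HB.instance Definition _ := GRing.Zmodule.on M.

Let scale (r : R) (x : M) : M := (x : 'rV_n) *m Phi r.

Fact matrix_module_scaleA r s x : scale r (scale s x) = scale (r * s) x.
Proof. by rewrite /scale PhiM mulmxA. Qed.
Fact matrix_module_scale1 : left_id 1 scale.
Proof. by move=> x; rewrite /scale Phi1 mulmx1. Qed.
Fact matrix_module_scaleDr : right_distributive scale +%R.
Proof. by move=> r x y; rewrite /scale mulmxDl. Qed.
Fact matrix_module_scaleDl x : {morph scale^~ x : r s / r + s}.
Proof. by move=> r s; rewrite /scale PhiD mulmxDr. Qed.

HB.instance Definition _ := GRing.Zmodule_isLmodule.Build R M
  matrix_module_scaleA matrix_module_scale1 matrix_module_scaleDr matrix_module_scaleDl.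

Lemma ex_matrix_module : exists (M : lmodType R) (b : M -> 'rV[K]_n),
  [/\ bijective b, {morph b : x y / x + y} & forall r x, b (r *: x) = b x *m Phi r].
Proof. by exists M, id; split=> //; exists id. Qed.

End MatrixModule.

Section PathAlgebraGenerators.
Variables (K : fieldType) (Q : quiver).
Local Notation V := (vertex Q).
Local Notation KQ := (pathalg K Q).
Implicit Types (u v : V) (x y : arrow Q) (p q : qpath Q) (f : KQ).

Definition has_arrow : rel V := fun u v => [exists x, (source x == u) && (target x == v)].

Definition path_vertex v : KQ := << 1 *g qtriv v >>.
Lemma arrow_is_qpath x : is_qpath (source x) [:: x].
Proof. by rewrite /= eqxx. Qed.
Definition path_arrow x : KQ := << 1 *g QPath (arrow_is_qpath x : is_qpath (source x, [:: x]).1 (source x, [:: x]).2) >>.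
Definition path_arrows : KQ := \sum_x path_arrow x.

Hypothesis simple : forall x y, source x = source y -> target x = target y -> x = y.
Hypothesis acyc : acyclic Q.

Lemma pathalg_mulE c d p q : (<< c *g p >> : KQ) * << d *g q >> = pathalgU (c * d) (qcomp p q).
Proof. exact: pathalg_mulUU. Qed.

Lemma pathalg_scalarU c p : (<< c *g p >> : KQ) = c%:A * (<< 1 *g p >> : KQ).
Proof.
rewrite -pathalg_scaleAl [1 * _]mul1r -[<< 1 *g p >>]/(pathalgU 1 (Some p)).
by rewrite pathalgUZ mulr1.
Qed.

Lemma path_vertex_orth u v :
  path_vertex u * path_vertex v = if u == v then path_vertex u else 0.
Proof. by rewrite pathalg_mulE qcomp1p mulr1 /qsource /=; case: eqP => [->|]. Qed.

Lemma path_vertex_arrow v x :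
  path_vertex v * path_arrow x = if v == source x then path_arrow x else 0.
Proof. by rewrite pathalg_mulE qcomp1p mulr1 /qsource /=; case: eqP. Qed.

Lemma path_arrow_vertex v x :
  path_arrow x * path_vertex v = if v == target x then path_arrow x else 0.
Proof. by rewrite pathalg_mulE qcompp1 mulr1 /qtarget /endpoint /=; case: eqP. Qed.

Lemma path_vertex_sum : \sum_v path_vertex v = 1.
Proof. by []. Qed.

Lemma path_arrows_between u v :
  path_vertex u * path_arrows * path_vertex v =
  \sum_(x | (source x == u) && (target x == v)) path_arrow x.
Proof.
rewrite mulr_sumr mulr_suml [RHS]big_mkcond; apply: eq_bigr => x _.
rewrite path_vertex_arrow (eq_sym u); case: eqP => _ /=; last by rewrite mul0r.
by rewrite path_arrow_vertex eq_sym.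
Qed.

(** Without parallel arrows the single element [path_arrows] and the trivial paths recover each
    arrow, so one matrix [A] carries the whole representation. *)
Lemma path_arrow_between x :
  path_vertex (source x) * path_arrows * path_vertex (target x) = path_arrow x.
Proof.
rewrite path_arrows_between (big_pred1 x) // => y.
by apply/andP/eqP => [[/eqP h1 /eqP h2]|->//]; exact: simple.
Qed.

Lemma pathalg_gen_ind (P : KQ -> Prop) : (forall f g, P f -> P g -> P (f + g)) ->
  (forall f g, P f -> P g -> P (f * g)) -> (forall c : K, P c%:A) ->
  (forall v, P (path_vertex v)) -> P path_arrows -> forall f, P f.
Proof.
move=> PD PM PK PV PA; apply: pathalg_ind => [|//|c p].
  by have := PK 0; rewrite scale0r.
rewrite pathalg_scalarU.
apply: (PM) => //; case: p => -[v s] /=; elim: s v => [|x s IHs] v vs.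
  by rewrite (_ : QPath _ = qtriv v); [exact: PV | exact: val_inj].
have /andP[/eqP xv xs] := vs.
rewrite (_ : << 1 *g _ >> = path_arrow x * << 1 *g QPath (xs : is_qpath (target x, s).1 (target x, s).2) >>).
  by apply: (PM); [rewrite -path_arrow_between; apply: (PM) => //; exact: (PM) | exact: IHs].
rewrite pathalg_mulE mulr1; case: qcompP => [r _ rs ra _|]; last by [].
by have -> : r = @QPath Q (v, x :: s) vs by apply: qpath_eq; rewrite ?rs ?ra.
Qed.

Let rk v := #|connect has_arrow v|.

(** [rk] counts the vertices reachable from [v]. All successors of [v] can be reached from [u],
    while a way from [v] back to [u] would close a cycle. *)
Lemma has_arrow_rank u v : has_arrow u v -> (rk v < rk u)%N.
Proof.
move=> uv; apply: proper_card; apply/properP; split.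
  by apply/subsetP => w; rewrite !unfold_in; apply: connect_trans; exact: connect1.
exists u; first exact: connect0.
apply/negP; rewrite -[_ \in _]/(connect has_arrow v u) => /connectP[s vs us].
have [t [tP tE]] : exists t, is_qpath v t /\ endpoint v t = last v s.
  elim: s v vs {uv us} => [|w s IHs] v /=; first by exists [::].
  move=> /andP[/existsP[x /andP[/eqP xv /eqP xw]] /IHs[t [tP tE]]].
  by exists (x :: t); rewrite /= xv eqxx /endpoint /= xw.
have /existsP[x /andP[/eqP xu /eqP xv]] := uv.
have cP : is_qpath (u, x :: t).1 (u, x :: t).2 by rewrite /= xu xv eqxx.
by have := acyc (p := QPath cP); rewrite /qtarget /qsource /endpoint /= xv [last _ _]tE -us => /(_ erefl).
Qed.

Lemma size_qpath v s : is_qpath v s -> (size s <= rk v)%N.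
Proof.
elim: s v => //= x s IHs v /andP[/eqP xv /IHs le].
apply: leq_ltn_trans le (has_arrow_rank _).
by apply/existsP; exists x; rewrite xv !eqxx.
Qed.

Lemma pathalg_finite : exists (T : finType) (s : T -> KQ), forall f, exists c : T -> K,
  f = \sum_t (c t)%:A * s t.
Proof.
(* Paths have length at most [#|V|], so start vertices with bounded tuples of arrows suffice as
   indices; [insub] sends sequences that are not paths to [0]. *)
pose T : finType := {m : 'I_#|V|.+1 & (V * m.-tuple (arrow Q))%type}.
pose s (t : T) : KQ := pathalgU 1 (insub ((tagged t).1, val (tagged t).2)).
exists T, s; have Z0 : 0 = \sum_t (0 : K)%:A * s t.
  by rewrite big1 // => t _; rewrite scale0r mul0r.
apply: pathalg_ind => [|f g [c ->] [d ->]|c p].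
- by exists (fun=> 0).
- exists (fun t => c t + d t); rewrite -big_split; apply: eq_bigr => t _.
  by rewrite scalerDl mulrDl.
have [t ts] : exists t, s t = << 1 *g p >>.
  case: p => -[v r] /= vr.
  have rV : (size r < #|V|.+1)%N by rewrite ltnS (leq_trans (size_qpath vr)) // max_card.
  exists (Tagged (fun m : 'I_#|V|.+1 => (V * m.-tuple (arrow Q))%type) (i := Ordinal rV) (v, in_tuple r)).
  by rewrite /s /= insubT.
exists (fun t' => if t' == t then c else 0).
apply/esym; apply: etrans (bigD1 t isT) _.
rewrite [t == t]eqxx ts big1 => [|t' /negPf->]; last by rewrite scale0r mul0r.
rewrite pathalg_scalarU; exact: addr0.
Qed.

Section PathRepresentation.
Variables (n : nat) (E : V -> 'M[K]_n) (A : 'M[K]_n).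
Hypotheses (repA : is_rep has_arrow E A) (sumE : \sum_v E v = 1%:M).

Let EE : orth_idem E. Proof. by case: repA. Qed.

Definition arrow_mx x := E (source x) *m A *m E (target x).

Fixpoint arrows_mx v (s : seq (arrow Q)) : 'M[K]_n :=
  if s is x :: s' then arrow_mx x *m arrows_mx (target x) s' else E v.

Definition qpath_mx p := arrows_mx (qsource p) (qarrows p).

Lemma arrows_mx_source u v s : is_qpath v s ->
  E u *m arrows_mx v s = if u == v then arrows_mx v s else 0.
Proof.
case: s => [|x s] /=; first by rewrite EE; case: eqP => [->|].
by move=> /andP[/eqP<- _]; rewrite !mulmxA EE; case: eqP => [->|]; rewrite ?mul0mx.
Qed.

Lemma arrows_mx_target v s : is_qpath v s -> arrows_mx v s *m E (endpoint v s) = arrows_mx v s.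
Proof.
elim: s v => [|x s IHs] v /=; first by rewrite EE eqxx.
by move=> /andP[_ /IHs xs]; rewrite -mulmxA xs.
Qed.

Lemma arrows_mx_cat v s t : is_qpath v (s ++ t) ->
  arrows_mx v (s ++ t) = arrows_mx v s *m arrows_mx (endpoint v s) t.
Proof.
elim: s v => [|x s IHs] v /=; first by move/(arrows_mx_source v)->; rewrite eqxx.
by move=> /andP[_ /IHs->]; rewrite mulmxA.
Qed.

Lemma qpath_mxM p q : qpath_mx p *m qpath_mx q =
  if qcomp p q is Some r then qpath_mx r else 0.
Proof.
case: qcompP => [r pq rs ra _|pq].
  rewrite /qpath_mx rs ra arrows_mx_cat -?pq //.
  by rewrite -ra -rs; exact: (valP r).
rewrite /qpath_mx -(arrows_mx_target (valP p)) -mulmxA arrows_mx_source ?(valP q) //.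
by case: eqP => [/pq|_]; rewrite ?mulmx0.
Qed.

Definition pathalg_mx f : 'M[K]_n := \sum_(p <- msupp f) f@_p *: qpath_mx p.

Lemma pathalg_mxw (d : {fset qpath Q}) f : (msupp f `<=` d)%fset ->
  pathalg_mx f = \sum_(p <- d) f@_p *: qpath_mx p.
Proof.
move=> fd; rewrite /pathalg_mx (big_fset_incl _ fd) // => p _ /mcoeff_outdom ->.
by rewrite scale0r.
Qed.

Lemma pathalg_mxD : {morph pathalg_mx : f g / f + g}.
Proof.
move=> f g; rewrite (pathalg_mxw (msuppD_le f g)).
rewrite (pathalg_mxw (fsubsetUl (msupp f) (msupp g))).
rewrite (pathalg_mxw (fsubsetUr (msupp f) (msupp g))).
by rewrite -big_split; apply: eq_bigr => p _; rewrite mcoeffD scalerDl.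
Qed.

Lemma pathalg_mx0 : pathalg_mx 0 = 0.
Proof. by apply: (addrI (pathalg_mx 0)); rewrite -pathalg_mxD !addr0. Qed.

Lemma pathalg_mxU c p : pathalg_mx << c *g p >> = c *: qpath_mx p.
Proof. by rewrite (pathalg_mxw msuppU_le) big_seq_fset1 mcoeffUU. Qed.

Lemma pathalg_mxM f g : pathalg_mx (f * g) = pathalg_mx f *m pathalg_mx g.
Proof.
rewrite -[f * g]/(pathalg_mul f g).
elim/pathalg_ind: f => [|f1 f2 IH1 IH2|c p].
- by rewrite pathalg_mul0l pathalg_mx0 mul0mx.
- rewrite pathalg_mulDl (pathalg_mxD f1) mulmxDl; apply: etrans (pathalg_mxD _ _) _.
  by congr (_ + _).
elim/pathalg_ind: g => [|g1 g2 IH1 IH2|d q].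
- by rewrite pathalg_mul0r pathalg_mx0 mulmx0.
- rewrite pathalg_mulDr (pathalg_mxD g1) mulmxDr; apply: etrans (pathalg_mxD _ _) _.
  by congr (_ + _).
rewrite pathalg_mulUU [X in _ = X *m _]pathalg_mxU [X in _ = _ *m X]pathalg_mxU.
rewrite -scalemxAl -scalemxAr scalerA qpath_mxM.
case: qcomp => [r|]; first exact: pathalg_mxU.
by rewrite scaler0; exact: pathalg_mx0.
Qed.

Lemma pathalg_mx_vertex v : pathalg_mx (path_vertex v) = E v.
Proof. by rewrite pathalg_mxU scale1r. Qed.

Lemma pathalg_mx1 : pathalg_mx 1 = 1%:M.
Proof.
rewrite -path_vertex_sum (big_morph _ pathalg_mxD pathalg_mx0) -sumE.
by apply: eq_bigr => v _; rewrite pathalg_mx_vertex.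
Qed.

Lemma pathalg_mxZ c f : pathalg_mx (c *: f) = c *: pathalg_mx f.
Proof.
rewrite (pathalg_mxw (msuppZ_le c f)) scaler_sumr; apply: eq_bigr => p _.
by rewrite mcoeffZ scalerA.
Qed.

Lemma pathalg_mx_arrows : pathalg_mx path_arrows = A.
Proof.
have [_ eA Ae arr] := repA.
rewrite (big_morph _ pathalg_mxD pathalg_mx0).
transitivity (\sum_x arrow_mx x).
  apply: eq_bigr => x _; rewrite pathalg_mxU scale1r /qpath_mx /= /arrow_mx.
  by rewrite -mulmxA EE eqxx.
rewrite -[RHS]eA -[X in _ *m X]Ae mulmxA mulmx_suml mulmx_suml.
under [RHS]eq_bigr do rewrite mulmx_sumr.
rewrite pair_bigA (partition_big (fun x => (source x, target x)) predT) //=.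
apply: eq_bigr => -[u v] _ /=; case: (boolP (has_arrow u v)) => [/existsP[x xuv]|ouv].
  rewrite (big_pred1 x) => [|y].
    by move: xuv => /andP[/eqP<- /eqP<-].
  rewrite xpair_eqE; move: xuv => /andP[/eqP<- /eqP<-].
  by apply/andP/eqP => [[/eqP h1 /eqP h2]|->//]; exact: simple.
rewrite arr // big_pred0 // => x; apply: contraNF ouv; rewrite xpair_eqE => xuv.
by apply/existsP; exists x.
Qed.

End PathRepresentation.
End PathAlgebraGenerators.

Lemma mul_converse (R : pzRingType) (x y : R) : (x : R^c) * (y : R^c) = y * x :> R.
Proof. by []. Qed.

Section PathAlgebraQuiverRing.
Variables (K : fieldType) (Q : quiver).
Local Notation V := (vertex Q).
Local Notation KQ := (pathalg K Q).
Hypothesis simple : forall x y : arrow Q, source x = source y -> target x = target y -> x = y.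
Hypothesis acyc : acyclic Q.

Let k (c : K) : KQ := c%:A.

Let kD : {morph k : c d / c + d}. Proof. by move=> c d; rewrite /k scalerDl. Qed.
Let kC c (f : KQ) : k c * f = f * k c.
Proof. by rewrite /k -[LHS]scalerAl -[RHS]scalerAr mul1r mulr1. Qed.
Let kM c d : k (c * d) = k c * k d.
Proof. by rewrite /k -[RHS]scalerAl mul1r scalerA. Qed.
Let k1 : k 1 = 1. Proof. exact: scale1r. Qed.

Let no_arrow u v : ~~ @has_arrow Q u v ->
  path_vertex K u * path_arrows K Q * path_vertex K v = 0.
Proof.
move=> uv; rewrite path_arrows_between big_pred0 // => x.
by apply: contraNF uv => xuv; apply/existsP; exists x.
Qed.

Lemma pathalg_right_quiver_ring :
  quiver_ring (R := KQ^c) (@has_arrow Q) k (@path_vertex K Q) (path_arrows K Q).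
Proof.
split.
- exact: kD.
- move=> c d; apply: etrans (esym (@mul_converse KQ (k c) (k d))).
  by rewrite -kM mulrC.
- exact: k1.
- move=> c f; apply: etrans (@mul_converse KQ _ _) _.
  by apply: etrans (esym (@mul_converse KQ _ _)); rewrite kC.
- move=> u v; apply: etrans (@mul_converse KQ _ _) _.
  apply: etrans (path_vertex_orth K v u) _; rewrite eq_sym.
  by case: eqP => [->|].
- exact: path_vertex_sum.
- by move=> u v /no_arrow; apply: etrans; exact: mulrA.
- move=> P PD PM PK PV PA; apply: (pathalg_gen_ind simple PD _ PK PV PA) => f g Pf Pg.
  exact: (PM g f).
- have [T [s sg]] := pathalg_finite K acyc; exists T, s => f.
  have [c fE] := sg f; exists c; rewrite {1}fE; apply: eq_bigr => t _; exact: kC.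
- move=> n E A repA sumE.
  have [|||M [b [bb bD bM]]] := @ex_matrix_module K (KQ^c) n (pathalg_mx E A).
  + exact: pathalg_mxD.
  + exact: pathalg_mx1.
  + by move=> f g; exact: pathalg_mxM.
  exists M, b; split=> //.
  + move=> c x; rewrite bM pathalg_mxZ (pathalg_mx1 A sumE) scalemx1.
    by rewrite mul_mx_scalar.
  + by move=> v x; rewrite bM pathalg_mx_vertex.
  + by move=> x; rewrite bM (pathalg_mx_arrows simple repA).
Qed.

Lemma pathalg_left_quiver_ring :
  quiver_ring (R := KQ) (opp_rel (@has_arrow Q)) k (@path_vertex K Q) (path_arrows K Q).
Proof.
split.
- exact: kD.
- exact: kM.
- exact: k1.
- exact: kC.
- exact: path_vertex_orth.
- exact: path_vertex_sum.
- by move=> u v; exact: no_arrow.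
- exact: (pathalg_gen_ind simple).
- exact: pathalg_finite.
- move=> n E A [EE eA Ae arr] sumE.
  (* [pathalg_mx] preserves products, as suits right modules. For left modules transposing both the
     representation and the result reverses products and arrows. *)
  pose ET v := (E v)^T.
  have sumET : \sum_v ET v = 1%:M by rewrite -raddf_sum sumE /= trmx1.
  have repT : is_rep (@has_arrow Q) ET A^T.
    split; rewrite ?sumET ?mulmx1 ?mul1mx //.
    + by move=> u v; rewrite -trmx_mul EE eq_sym; case: eqP => [->|]; rewrite ?trmx0.
    + by move=> u v uv; rewrite -!trmx_mul mulmxA arr ?trmx0.
  have [|||M [b [bb bD bM]]] := @ex_matrix_module K KQ n (fun f => (pathalg_mx ET A^T f)^T).
  + by move=> f g; rewrite pathalg_mxD raddfD.
  + by rewrite (pathalg_mx1 _ sumET) trmx1.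
  + move=> f g; exact: etrans (congr1 trmx (pathalg_mxM repT f g)) (trmx_mul _ _).
  exists M, b; split=> //.
  + move=> c x; rewrite bM pathalg_mxZ (pathalg_mx1 _ sumET) scalemx1.
    by rewrite tr_scalar_mx mul_mx_scalar.
  + by move=> v x; rewrite bM pathalg_mx_vertex /ET trmxK.
  + by move=> x; rewrite bM (pathalg_mx_arrows simple repT) trmxK.
Qed.

End PathAlgebraQuiverRing.

(** A topological sort: listing the vertices by increasing [rk] puts targets before sources. *)
Lemma ex_list_orient (V : finType) (g o : rel V) (rk : V -> nat) :
  (forall u v, g u v = o u v || o v u) -> (forall u v, o u v -> (rk v < rk u)%N) ->
  exists p, [/\ uniq p, forall v, v \in p & o = list_orient g p].
Proof.
move=> go rko; pose p := sort (relpre rk leq) (enum V); exists p.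
have pV v : v \in p by rewrite mem_sort mem_enum.
split=> //; first by rewrite sort_uniq enum_uniq.
have ps : sorted (relpre rk leq) p by apply: sort_sorted => x y; exact: leq_total.
have oi u v : o u v -> (index v p < index u p)%N.
  move=> /rko; rewrite !ltnNge; apply: contra.
  apply: (sorted_leq_index _ _ ps) => //.
    by move=> y x z; exact: leq_trans.
  by move=> x /=.
apply/funext => u; apply/funext => v; rewrite /list_orient go.
case: (boolP (o u v)) => [/oi->//|_] /=.
by case: (boolP (o v u)) => //= /oi uv; rewrite ltnNge ltnW.
Qed.

Section GraphTransport.
Variables (V T : finType) (g : rel V) (e : rel T) (phi : V -> T) (psi : T -> V).
Hypotheses (phiK : cancel phi psi) (psiK : cancel psi phi).
Hypothesis ge : forall u v, g u v = e (phi u) (phi v).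

Lemma sum_transport (F : V -> int) (P : pred V) :
  \sum_(v | P v) F v = \sum_(t | P (psi t)) F (psi t).
Proof.
rewrite (reindex psi) //; exists phi => x _; [exact: psiK|exact: phiK].
Qed.

Lemma tits2_transport (x : V -> int) : tits2 g x = tits2 e (x \o psi).
Proof.
rewrite /tits2 sum_transport; apply: eq_bigr => t _ /=; congr (_ * _).
rewrite /cartan /= sum_transport; congr (_ - _); apply: eq_bigl => s.
by rewrite ge !psiK.
Qed.

End GraphTransport.

Lemma nakayama_graph (K : fieldType) (Q : quiver) (T : finType) (e : rel T) (C h : nat)
    (theta : T -> int) :
  acyclic Q -> underlying_graph_is Q e -> irreflexive e ->
  (forall x t, `|x t| <= C%:R * tits2 e x) -> (#|T| < h)%N ->
  (forall x, (forall t, 0 <= x t) -> tits2 e x = 2 -> \sum_t x t <= h%:Z) ->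
  (forall t, 0 <= theta t) -> tits2 e theta = 2 -> \sum_t theta t = h%:Z ->
  nakayama (pathalg K Q) h.
Proof.
move=> acyc [phi [psi phiK psiK] nbE] e_irr bound Th le_h th0 th2 thh.
pose g : rel (vertex Q) := fun u v => (0 < nb_edges u v)%N.
have ge u v : g u v = e (phi u) (phi v) by rewrite /g nbE; case: (e _ _).
have go u v : g u v = has_arrow u v || has_arrow v u.
  rewrite /g /nb_edges card_gt0; apply/set0Pn/orP => [[x]|].
    rewrite inE !xpair_eqE => /orP[xuv|/andP[xv xu]]; [left|right];
      apply/existsP; exists x => //; by rewrite xv xu.
  by move=> [] /existsP[x /andP[xu xv]]; exists x; rewrite inE !xpair_eqE xu xv ?orbT.
have simple (x y : arrow Q) : source x = source y -> target x = target y -> x = y.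
  move=> sxy txy; have : (nb_edges (source x) (target x) <= 1)%N by rewrite nbE; case: (e _ _).
  by move/card_le1_eqP; apply; rewrite inE ?sxy ?txy !eqxx.
have g_sym : symmetric g by move=> u v; rewrite !go orbC.
have g_irr : irreflexive g by move=> u; rewrite ge e_irr.
pose rk (v : vertex Q) := #|connect (@has_arrow Q) v|.
have rkP u v : has_arrow u v -> (rk v < rk u)%N.
  by move=> uv; apply: has_arrow_rank acyc _ _ uv.
have boundg x v : `|x v| <= C%:R * tits2 g x.
  by rewrite (tits2_transport phiK psiK ge); have := bound (x \o psi) (phi v); rewrite /= phiK.
have cardV : (#|vertex Q| < h)%N by rewrite (bij_eq_card (Bijective phiK psiK)).
have le_hg x : (forall v, 0 <= x v) -> tits2 g x = 2 -> \sum_v x v <= h%:Z.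
  move=> x0; rewrite (tits2_transport phiK psiK ge) (sum_transport phiK psiK) => x2.
  by apply: le_h x2 => t; exact: x0.
have th0' v : 0 <= theta (phi v) by [].
have thE : (theta \o phi) \o psi = theta by apply/funext => t /=; rewrite psiK.
have th2' : tits2 g (theta \o phi) = 2 by rewrite (tits2_transport phiK psiK ge) thE.
have thh' : \sum_v theta (phi v) = h%:Z.
  rewrite (sum_transport phiK psiK) -thh; apply: eq_bigr => t _; by rewrite psiK.
split.
  have [p [up pV oE]] := ex_list_orient go rkP.
  have QR := pathalg_right_quiver_ring K simple acyc; rewrite oE in QR.
  exact: (left_nakayama_height g_sym g_irr boundg up pV QR cardV le_hg th0' th2' thh').
have rk_le v : (rk v <= #|vertex Q|)%N by exact: max_card.
(* Left modules are representations of the opposite quiver, and the complementary rank decreases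
   along its arrows. *)
have [||p [up pV oE]] := @ex_list_orient _ g (opp_rel (@has_arrow Q)) (fun v => #|vertex Q| - rk v)%N.
- by move=> u v; rewrite go orbC.
- by move=> u v /rkP; have := rk_le u; have := rk_le v; lia.
have QR := pathalg_left_quiver_ring K simple acyc; rewrite oE in QR.
exact: (left_nakayama_height g_sym g_irr boundg up pV QR cardV le_hg th0' th2' thh').
Qed.

(** * Dynkin graphs *)

Lemma tits2_edges n (edge : rel nat) (f : nat -> int) :
  (forall i j, edge i j -> ~~ edge j i) ->
  tits2 (fun i j : 'I_n => edge i j || edge j i) (fun i => f i) =
  2 * (\sum_(0 <= i < n) f i ^+ 2 -
       \sum_(0 <= i < n) \sum_(0 <= j < n | edge i j) f i * f j).
Proof.
move=> asym; rewrite big_mkord; under [X in _ - X]eq_bigr do rewrite big_mkord.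
rewrite big_mkord.
have -> : tits2 (fun i j : 'I_n => edge i j || edge j i) (fun i => f i) =
  \sum_(i < n) f i ^+ 2 *+ 2 - \sum_(i < n) \sum_(j < n)
    ((if edge i j then f i * f j else 0) + (if edge j i then f j * f i else 0)).
  rewrite -sumrB /tits2; apply: eq_bigr => i _; rewrite /cartan mulrBr; congr (_ - _).
    by rewrite mulrnAr expr2.
  rewrite mulr_sumr big_mkcond; apply: eq_bigr => j _.
  have := asym i j; case: (edge i j) => /=; first by move=> /(_ isT)/negPf->; rewrite addr0.
  by case: (edge j i); rewrite add0r // mulrC.
set S := \sum_(i < n) \sum_(j < n | edge i j) f i * f j.
have SE : S = \sum_(i < n) \sum_(j < n) if edge i j then f i * f j else 0.
  by apply: eq_bigr => i _; rewrite big_mkcond.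
set D := (X in _ - X = _); have -> : D = S + S.
  rewrite {2}SE exchange_big /= SE -big_split; apply: eq_bigr => i _.
  by rewrite -big_split.
by rewrite sumrMnl; ring.
Qed.

(** The common shape of [dynkinD] and [dynkinE]: a chain from [0] to [k] and one more vertex
    attached to [b]. *)
Lemma sum_branch_edge k b (f : nat -> int) : (b <= k)%N ->
  \sum_(0 <= i < k.+2) \sum_(0 <= j < k.+2 | (((j == i.+1) && (j < k.+1)) ||
      ((i == b) && (j == k.+1)))%N) f i * f j =
  \sum_(0 <= i < k) f i * f i.+1 + f b * f k.+1.
Proof.
move=> bk.
transitivity (\sum_(0 <= i < k.+2) ((if (i < k)%N then f i * f i.+1 else 0) +
    (if i == b then f i * f k.+1 else 0))).
  apply: eq_bigr => i _; rewrite big_mkcond.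
  transitivity (\sum_(0 <= j < k.+2) ((if j == i.+1 then if (i < k)%N then f i * f j else 0 else 0) +
      (if j == k.+1 then if i == b then f i * f j else 0 else 0))).
    apply: eq_bigr => j _.
    have -> : (j == i.+1) && (j < k.+1)%N = (j == i.+1) && (i < k)%N by lia.
    have : ~~ [&& j == i.+1, (i < k)%N, i == b & j == k.+1] by lia.
    by case: (j == i.+1); case: (i < k)%N; case: (i == b); case: (j == k.+1);
      rewrite /= ?addr0 ?add0r.
  rewrite big_split -!big_mkcond !big_nat1_eq /= ltnSn; congr (_ + _).
  by case: (ltnP i k) => ik; [rewrite ifT //; lia | case: ifP].
rewrite big_split -[X in _ + X = _]big_mkcond big_nat1_eq /= ifT; last by lia.
rewrite (big_nat_recr k.+1) // (big_nat_recr k) //= ltnn ltnNge leqnSn /= !addr0.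
by congr (_ + _); rewrite [LHS]big_nat [RHS]big_nat; apply: eq_bigr => i /andP[_ ->].
Qed.

Lemma norm_le_sqr (t : int) : `|t| <= t ^+ 2.
Proof. by rewrite expr2; nia. Qed.

Lemma ord_fun_nat n (x : 'I_n -> int) : exists f : nat -> int, x = fun i => f i.
Proof.
exists (fun i => if insub i is Some j then x j else 0).
by apply/funext => i; rewrite valK.
Qed.

(** [x] is the value at the branch vertex, [y] at an end attached to it. If [y >= 2], the hypothesis
    would give [(x - 3) ^+ 2 + 3 <= 0]. *)
Lemma branch_le1 (x y : int) : x <= 2 -> (2 * y - x) ^+ 2 <= 4 - 2 * x -> y <= 1.
Proof.
move=> x2 h; rewrite leNgt; apply/negP => y1.
have : (4 - x) ^+ 2 <= (2 * y - x) ^+ 2 by rewrite ler_sqr ?nnegrE; lia.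
by rewrite expr2 in h *; have := sqr_ge0 (x - 3); rewrite !expr2 in h *; nia.
Qed.

Section DynkinD.
Variable m : nat.
Let n := m.+3.

Lemma dynkinD_edge_asym i j : dynkinD_edge n i j -> ~~ dynkinD_edge n j i.
Proof. rewrite /dynkinD_edge /n; lia. Qed.

Lemma dynkinD_irr : irreflexive (@dynkinD n).
Proof.
by move=> i; rewrite /dynkinD /dynkinD_edge /n; apply/negbTE; lia.
Qed.

Lemma chain_squares (f : nat -> int) :
  f 0%N ^+ 2 + \sum_(0 <= i < m) (f i - f i.+1) ^+ 2 =
  2 * (\sum_(0 <= i < m.+1) f i ^+ 2) - 2 * (\sum_(0 <= i < m) f i * f i.+1) - f m ^+ 2.
Proof.
elim: m => [|k IHk]; first by rewrite !big_nat1 !big_geq //; ring.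
rewrite !(big_nat_recr k.+1) // !(big_nat_recr k) //=; move: IHk.
rewrite (big_nat_recr k) //=; set S := \sum_(0 <= i < k) (_ - _) ^+ 2.
set S2 := \sum_(0 <= i < k) _ ^+ 2; set S1 := \sum_(0 <= i < k) _ * _.
move=> IH; rewrite addrA IH; ring.
Qed.

(** Squares are completed from vertex [0] along the chain and from the two short ends, all meeting
    at the branch vertex [m]. *)
Lemma tits2_dynkinD (f : nat -> int) :
  2 * tits2 (@dynkinD n) (fun i => f i) =
  2 * f 0%N ^+ 2 + 2 * (\sum_(0 <= i < m) (f i - f i.+1) ^+ 2) +
  (2 * f m.+1 - f m) ^+ 2 + (2 * f m.+2 - f m) ^+ 2.
Proof.
rewrite (tits2_edges n f dynkinD_edge_asym).
have m3 : (m.+3 - 3 = m)%N by lia.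
rewrite (@sum_branch_edge m.+1 (m.+3 - 3)) m3 ?leqnSn // (big_nat_recr m) //=.
rewrite /n (big_nat_recr m.+2) // (big_nat_recr m.+1) //=; have := chain_squares f.
set S := \sum_(0 <= i < m) (_ - _) ^+ 2; set S1 := \sum_(0 <= i < m) _ * _.
set S2 := \sum_(0 <= i < m.+1) _.
move=> h; have -> : 2 * f 0%N ^+ 2 + 2 * S = 2 * (f 0%N ^+ 2 + S) by ring.
by rewrite h; ring.
Qed.

(** The triangle inequality along the chain, with each absolute value bounded by its square since
    entries are integers. *)
Lemma chain_abs (f : nat -> int) i : (i <= m)%N ->
  `|f i| <= f 0%N ^+ 2 + \sum_(0 <= k < m) (f k - f k.+1) ^+ 2.
Proof.
move=> im; rewrite (big_cat_nat _ im) //= addrA ler_wpDr ?sumr_ge0 // => [k _|].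
  exact: sqr_ge0.
elim: i {im} => [|i IHi]; first by rewrite big_geq // addr0 norm_le_sqr.
rewrite big_nat_recr //= addrA; apply: le_trans (lerD IHi (norm_le_sqr (f i - f i.+1))); lia.
Qed.

Lemma dynkinD_bound (x : 'I_n -> int) t : `|x t| <= 2%:R * tits2 (@dynkinD n) x.
Proof.
have [f ->] := ord_fun_nat x; have := tits2_dynkinD f; have := chain_abs f.
set S := \sum_(0 <= k < m) _ => ch T2.
have u0 := sqr_ge0 (2 * f m.+1 - f m); have v0 := sqr_ge0 (2 * f m.+2 - f m).
have u1 := norm_le_sqr (2 * f m.+1 - f m); have v1 := norm_le_sqr (2 * f m.+2 - f m).
have xm := ch m (leqnn m); have f0 := ch 0%N (leq0n m).
move: T2 ch u0 v0 u1 v1 xm f0; move: (tits2 _ _) S (f 0%N ^+ 2) ((_ - _) ^+ 2) ((_ - _) ^+ 2).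
move=> /= T S f00 U W T2 ch u0 v0 u1 v1 xm f0.
have : (t < m.+3)%N by [].
rewrite ltnS leq_eqVlt => /orP[/eqP->|]; first by lia.
rewrite ltnS leq_eqVlt => /orP[/eqP->|]; first by lia.
by rewrite ltnS => /ch; lia.
Qed.

Lemma dynkinD_height (x : 'I_n -> int) : (forall t, 0 <= x t) ->
  tits2 (@dynkinD n) x = 2 -> \sum_t x t <= (2 * n - 3)%N%:Z.
Proof.
have [f ->] := ord_fun_nat x => x0 T2; have := tits2_dynkinD f; have := chain_abs f.
rewrite T2; set S := \sum_(0 <= k < m) _ => ch T2'.
have fi0 i : (i < n)%N -> 0 <= f i by move=> lt_in; exact: (x0 (Ordinal lt_in)).
have u0 := sqr_ge0 (2 * f m.+1 - f m); have v0 := sqr_ge0 (2 * f m.+2 - f m).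
have f0 : f 0%N <= 1.
  have S0 : 0 <= S by rewrite sumr_ge0 // => k _; exact: sqr_ge0.
  have := sqr_ge0 (f 0%N - 1); rewrite !expr2 in T2' *; nia.
have f2 i : (i <= m)%N -> f i <= 2 by move=> /ch; lia.
have xm := ch m (leqnn m); have xm2 := f2 m (leqnn m); have xm0 : 0 <= f m by apply: fi0; rewrite /n; lia.
have y0 : 0 <= f m.+1 by apply: fi0; rewrite /n; lia.
have z0 : 0 <= f m.+2 by apply: fi0; rewrite /n; lia.
have yz : f m.+1 + f m.+2 <= 2.
  have := branch_le1 (y := f m.+1) xm2; have := branch_le1 (y := f m.+2) xm2.
  move: T2' xm xm0 u0 v0 {ch}; move: S (f 0%N ^+ 2) ((_ - _) ^+ 2) ((_ - _) ^+ 2) => /= S f00 U W.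
  by lia.
(* Entry [0] is at most [1] and the other [m] entries up to the branch vertex at most [2]. With [2]
   for the two short ends this makes [2m + 3 = 2n - 3]. *)
have chain : \sum_(0 <= i < m.+1) f i <= 2 * m%:Z + 1.
  elim: m f2 => [|k IHk] f2'; first by rewrite big_nat1; lia.
  rewrite big_nat_recr //=.
  by apply: le_trans (lerD (IHk (fun i ik => f2' i (leqW ik))) (f2' _ (leqnn _))) _; lia.
rewrite -(big_mkord predT f) /n (big_nat_recr m.+2) // (big_nat_recr m.+1) //= -addrA.
by apply: le_trans (lerD chain yz) _; lia.
Qed.

End DynkinD.

(** The root [1, 2, ..., 2, 1, 1], with ones at the three ends of the diagram. *)
Lemma dynkinD_highest_root m : exists theta : 'I_m.+4 -> int,
  [/\ forall t, 0 <= theta t, tits2 (@dynkinD m.+4) theta = 2 &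
      \sum_t theta t = (2 * m.+4 - 3)%N%:Z].
Proof.
pose f i : int := if (0 < i < m.+2)%N then 2 else 1.
exists (fun i => f i); split.
- by move=> t; rewrite /f; case: ifP.
- have f0 : f 0%N = 1 by [].
  have f1 : f m.+1 = 2 by rewrite /f /= ltnSn.
  have f2 : f m.+2 = 1 by rewrite /f /= ltnn.
  have f3 : f m.+3 = 1 by rewrite /f /= ifF //; lia.
  have := tits2_dynkinD m.+1 f; rewrite f0 f1 f2 f3.
  have -> : \sum_(0 <= i < m.+1) (f i - f i.+1) ^+ 2 = 1.
    rewrite big_nat_recl // big_nat_cond big1 /f /= ?ltnS // => i /andP[im _].
    by rewrite !ifT ?subrr //; lia.
  move: (tits2 _ _) => /= T; lia.
- rewrite -(big_mkord predT f) (big_nat_recr m.+3) // (big_nat_recr m.+2) // big_nat_recl //=.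
  have -> : \sum_(0 <= i < m.+1) f i.+1 = 2 * m.+1%:Z.
    rewrite big_nat (eq_bigr (fun=> 2)) => [|i im]; last by rewrite /f ifT.
    by rewrite -big_nat sumr_const_nat subn0 -mulr_natr; lia.
  rewrite /f /= ltnn ifF; lia.
Qed.

(** Half of [tits2] for [E_8]; dropping the last vertices of the long arm gives
    [E_7] ([a6 = 0]) and [E_6] ([a5 = a6 = 0]). *)
Definition e8_form (a0 a1 a2 a3 a4 a5 a6 a7 : int) : int :=
  a0 ^+ 2 + a1 ^+ 2 + a2 ^+ 2 + a3 ^+ 2 + a4 ^+ 2 + a5 ^+ 2 + a6 ^+ 2 + a7 ^+ 2
  - a0 * a1 - a1 * a2 - a2 * a3 - a3 * a4 - a4 * a5 - a5 * a6 - a2 * a7.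

(* Completing squares from the ends of the three arms towards the branch vertex. *)
Lemma e8_form_squares a0 a1 a2 a3 a4 a5 a6 a7 :
  120 * e8_form a0 a1 a2 a3 a4 a5 a6 a7 =
  30 * (2 * a0 - a1) ^+ 2 + 10 * (3 * a1 - 2 * a2) ^+ 2 + 30 * (2 * a7 - a2) ^+ 2 +
  30 * (2 * a6 - a5) ^+ 2 + 10 * (3 * a5 - 2 * a4) ^+ 2 + 5 * (4 * a4 - 3 * a3) ^+ 2 +
  3 * (5 * a3 - 4 * a2) ^+ 2 + 2 * a2 ^+ 2.
Proof. by rewrite /e8_form; ring. Qed.

(** Each square is at most [60 * q], and the entries are recovered from the squared linear forms
    starting at [a2]. The constant [200] is generous; it becomes [100] for [tits2], which is twice
    the form. *)
Lemma e8_form_bound a0 a1 a2 a3 a4 a5 a6 a7 (q := e8_form a0 a1 a2 a3 a4 a5 a6 a7) :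
  `|a0| <= 200 * q /\ `|a1| <= 200 * q /\ `|a2| <= 200 * q /\ `|a3| <= 200 * q /\
  `|a4| <= 200 * q /\ `|a5| <= 200 * q /\ `|a6| <= 200 * q /\ `|a7| <= 200 * q.
Proof.
have := e8_form_squares a0 a1 a2 a3 a4 a5 a6 a7; rewrite -/q; move: q => q.
have := norm_le_sqr (2 * a0 - a1); move: (_ ^+ 2) => s0.
have := norm_le_sqr (3 * a1 - 2 * a2); move: (_ ^+ 2) => s1.
have := norm_le_sqr (2 * a7 - a2); move: (_ ^+ 2) => s2.
have := norm_le_sqr (2 * a6 - a5); move: (_ ^+ 2) => s3.
have := norm_le_sqr (3 * a5 - 2 * a4); move: (_ ^+ 2) => s4.
have := norm_le_sqr (4 * a4 - 3 * a3); move: (_ ^+ 2) => s5.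
have := norm_le_sqr (5 * a3 - 4 * a2); move: (_ ^+ 2) => s6.
have := norm_le_sqr a2; move: (_ ^+ 2) => s7.
move=> h7 h6 h5 h4 h3 h2 h1 h0 e.
by do !split; lia.
Qed.

(* The windows are those that [e8_form_squares] leaves open when the form is [1]. *)
Definition near (c a d b r : nat) : bool := ((c * a <= d * b + r) && (d * b <= c * a + r))%N.

Definition e8_height_check : bool :=
  all (fun a2 => all (fun a1 => all (fun a0 => all (fun a7 =>
  all (fun a3 => all (fun a4 => all (fun a5 => all (fun a6 =>
    ((a0 * a0 + a1 * a1 + a2 * a2 + a3 * a3 + a4 * a4 + a5 * a5 + a6 * a6 + a7 * a7 ==
      (a0 * a1 + a1 * a2 + a2 * a3 + a3 * a4 + a4 * a5 + a5 * a6 + a2 * a7).+1)%N ==>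
     [&& (a0 + a1 + a2 + a3 + a4 + a5 + a6 + a7 <= 29)%N,
      (a6 == 0%N) ==> (a0 + a1 + a2 + a3 + a4 + a5 + a6 + a7 <= 17)%N &
      ((a5 == 0%N) && (a6 == 0%N)) ==> (a0 + a1 + a2 + a3 + a4 + a5 + a6 + a7 <= 11)%N]))
  [seq a6 <- iota 0 4 | near 2 a6 1 a5 2]) [seq a5 <- iota 0 5 | near 3 a5 2 a4 3])
  [seq a4 <- iota 0 6 | near 4 a4 3 a3 4]) [seq a3 <- iota 0 7 | near 5 a3 4 a2 6])
  [seq a7 <- iota 0 5 | near 2 a7 1 a2 2]) [seq a0 <- iota 0 4 | near 2 a0 1 a1 2])
  [seq a1 <- iota 0 6 | near 3 a1 2 a2 3]) (iota 0 8).

Lemma e8_height_checked : e8_height_check.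
Proof. by vm_compute. Qed.

(** The weighted squares add up to [120]. The bounds [2], [3], [4], [6], [7] below are the integer
    square roots of [120] divided by the weights [30], [10], [5], [3], [2]; they leave the finite
    box that is searched by computation. *)
Lemma e8_form_height (a0 a1 a2 a3 a4 a5 a6 a7 : nat) (s := (a0 + a1 + a2 + a3 + a4 + a5 + a6 + a7)%N) :
  e8_form a0 a1 a2 a3 a4 a5 a6 a7 = 1 ->
  (s <= 29)%N /\ (a6 = 0%N -> (s <= 17)%N) /\ (a5 = 0%N -> a6 = 0%N -> (s <= 11)%N).
Proof.
move=> q1; have := e8_form_squares a0 a1 a2 a3 a4 a5 a6 a7; rewrite q1.
have sq (x r : int) : 0 <= r -> x ^+ 2 < (r + 1) ^+ 2 -> - r <= x <= r.
  by rewrite !expr2 => r0 h; nia.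
have g (x : int) := sqr_ge0 x.
have := g (2 * a0%:Z - a1%:Z); have := sq (2 * a0%:Z - a1%:Z) 2 isT; move: (_ ^+ 2) => s0.
have := g (3 * a1%:Z - 2 * a2%:Z); have := sq (3 * a1%:Z - 2 * a2%:Z) 3 isT; move: ((3 * a1%:Z - _) ^+ 2) => s1.
have := g (2 * a7%:Z - a2%:Z); have := sq (2 * a7%:Z - a2%:Z) 2 isT; move: ((2 * a7%:Z - _) ^+ 2) => s2.
have := g (2 * a6%:Z - a5%:Z); have := sq (2 * a6%:Z - a5%:Z) 2 isT; move: ((2 * a6%:Z - _) ^+ 2) => s3.
have := g (3 * a5%:Z - 2 * a4%:Z); have := sq (3 * a5%:Z - 2 * a4%:Z) 3 isT; move: ((3 * a5%:Z - _) ^+ 2) => s4.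
have := g (4 * a4%:Z - 3 * a3%:Z); have := sq (4 * a4%:Z - 3 * a3%:Z) 4 isT; move: ((4 * a4%:Z - _) ^+ 2) => s5.
have := g (5 * a3%:Z - 4 * a2%:Z); have := sq (5 * a3%:Z - 4 * a2%:Z) 6 isT; move: ((5 * a3%:Z - _) ^+ 2) => s6.
have := g a2%:Z; have := sq a2%:Z 7 isT; move: (a2%:Z ^+ 2) => s7.
move=> b7 g7 b6 g6 b5 g5 b4 g4 b3 g3 b2 g2 b1 g1 b0 g0 e.
have {b0}b0 : - 2%:Z <= 2 * a0%:Z - a1%:Z <= 2 by apply: b0; rewrite !expr2; lia.
have {b1}b1 : - 3%:Z <= 3 * a1%:Z - 2 * a2%:Z <= 3 by apply: b1; rewrite !expr2; lia.
have {b2}b2 : - 2%:Z <= 2 * a7%:Z - a2%:Z <= 2 by apply: b2; rewrite !expr2; lia.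
have {b3}b3 : - 2%:Z <= 2 * a6%:Z - a5%:Z <= 2 by apply: b3; rewrite !expr2; lia.
have {b4}b4 : - 3%:Z <= 3 * a5%:Z - 2 * a4%:Z <= 3 by apply: b4; rewrite !expr2; lia.
have {b5}b5 : - 4%:Z <= 4 * a4%:Z - 3 * a3%:Z <= 4 by apply: b5; rewrite !expr2; lia.
have {b6}b6 : - 6%:Z <= 5 * a3%:Z - 4 * a2%:Z <= 6 by apply: b6; rewrite !expr2; lia.
have {b7}b7 : - 7%:Z <= a2%:Z <= 7 by apply: b7; rewrite !expr2; lia.
have := e8_height_checked; rewrite /e8_height_check.
move=> /allP/(_ a2); rewrite mem_iota => /(_ ltac:(lia)).
move=> /allP/(_ a1); rewrite mem_filter mem_iota => /(_ ltac:(rewrite /near; lia)).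
move=> /allP/(_ a0); rewrite mem_filter mem_iota => /(_ ltac:(rewrite /near; lia)).
move=> /allP/(_ a7); rewrite mem_filter mem_iota => /(_ ltac:(rewrite /near; lia)).
move=> /allP/(_ a3); rewrite mem_filter mem_iota => /(_ ltac:(rewrite /near; lia)).
move=> /allP/(_ a4); rewrite mem_filter mem_iota => /(_ ltac:(rewrite /near; lia)).
move=> /allP/(_ a5); rewrite mem_filter mem_iota => /(_ ltac:(rewrite /near; lia)).
move=> /allP/(_ a6); rewrite mem_filter mem_iota => /(_ ltac:(rewrite /near; lia)).
move=> /implyP h; have {}h := h ltac:(move: q1; rewrite /e8_form !expr2; lia).
move: h => /and3P[s29 s17 s11].
split=> //; split=> [a60|a50 a60].
  by move/implyP: s17; apply; rewrite a60.
by move/implyP: s11; apply; rewrite a50 a60.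
Qed.

Lemma dynkinE_edge_asym n i j : (3 < n)%N -> dynkinE_edge n i j -> ~~ dynkinE_edge n j i.
Proof. rewrite /dynkinE_edge; lia. Qed.

Lemma dynkinE_irr n : (3 < n)%N -> irreflexive (@dynkinE n).
Proof. by move=> n3 i; rewrite /dynkinE /dynkinE_edge; apply/negbTE; lia. Qed.

Lemma tits2_dynkinE8 (f : nat -> int) :
  tits2 (@dynkinE 8) (fun i => f i) =
  2 * e8_form (f 0%N) (f 1%N) (f 2%N) (f 3%N) (f 4%N) (f 5%N) (f 6%N) (f 7%N).
Proof.
rewrite (tits2_edges 8 f (fun i j => @dynkinE_edge_asym 8 i j isT)).
rewrite (@sum_branch_edge 6 2) // !big_nat_recr //= !big_geq //.
by rewrite /e8_form; ring.
Qed.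

(** The last vertex of each [dynkinE] is the short arm, hence goes to the slot [a7], with zeros for
    the missing end of the long arm. *)
Lemma tits2_dynkinE7 (f : nat -> int) :
  tits2 (@dynkinE 7) (fun i => f i) =
  2 * e8_form (f 0%N) (f 1%N) (f 2%N) (f 3%N) (f 4%N) (f 5%N) 0 (f 6%N).
Proof.
rewrite (tits2_edges 7 f (fun i j => @dynkinE_edge_asym 7 i j isT)).
rewrite (@sum_branch_edge 5 2) // !big_nat_recr //= !big_geq //.
by rewrite /e8_form; ring.
Qed.

Lemma tits2_dynkinE6 (f : nat -> int) :
  tits2 (@dynkinE 6) (fun i => f i) =
  2 * e8_form (f 0%N) (f 1%N) (f 2%N) (f 3%N) (f 4%N) 0 0 (f 5%N).
Proof.
rewrite (tits2_edges 6 f (fun i j => @dynkinE_edge_asym 6 i j isT)).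
rewrite (@sum_branch_edge 4 2) // !big_nat_recr //= !big_geq //.
by rewrite /e8_form; ring.
Qed.

Lemma mul2_eq2 (a : int) : 2 * a = 2 -> a = 1.
Proof. lia. Qed.

Lemma nat_of_int_fun n (f : nat -> int) : (forall t : 'I_n, 0 <= f t) ->
  forall i, (i < n)%N -> exists a : nat, f i = a.
Proof. by move=> f0 i lt_in; exists `|f i|%N; have := f0 (Ordinal lt_in); rewrite /=; lia. Qed.

Lemma dynkinE8_bound (x : 'I_8 -> int) t : `|x t| <= 100%:R * tits2 (@dynkinE 8) x.
Proof.
have [f ->] := ord_fun_nat x; rewrite tits2_dynkinE8 mulrA.
have [h0 [h1 [h2 [h3 [h4 [h5 [h6 h7]]]]]]] := e8_form_bound (f 0%N) (f 1%N) (f 2%N) (f 3%N) (f 4%N) (f 5%N) (f 6%N) (f 7%N).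
by case: t => -[|[|[|[|[|[|[|[|]]]]]]]].
Qed.

Lemma dynkinE8_height (x : 'I_8 -> int) : (forall t, 0 <= x t) ->
  tits2 (@dynkinE 8) x = 2 -> \sum_t x t <= 29%N%:Z.
Proof.
have [f ->] := ord_fun_nat x; rewrite tits2_dynkinE8 => /nat_of_int_fun f0.
rewrite !big_ord_recl big_ord0 /=.
have [a0 ->] := f0 0%N isT.
have [a1 ->] := f0 1%N isT.
have [a2 ->] := f0 2%N isT.
have [a3 ->] := f0 3%N isT.
have [a4 ->] := f0 4%N isT.
have [a5 ->] := f0 5%N isT.
have [a6 ->] := f0 6%N isT.
have [a7 ->] := f0 7%N isT.
move=> q2; have [] := @e8_form_height a0 a1 a2 a3 a4 a5 a6 a7 (mul2_eq2 q2); lia.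
Qed.

Lemma dynkinE7_bound (x : 'I_7 -> int) t : `|x t| <= 100%:R * tits2 (@dynkinE 7) x.
Proof.
have [f ->] := ord_fun_nat x; rewrite tits2_dynkinE7 mulrA.
have [h0 [h1 [h2 [h3 [h4 [h5 [h6 h7]]]]]]] := e8_form_bound (f 0%N) (f 1%N) (f 2%N) (f 3%N) (f 4%N) (f 5%N) 0 (f 6%N).
by case: t => -[|[|[|[|[|[|[|]]]]]]].
Qed.

Lemma dynkinE7_height (x : 'I_7 -> int) : (forall t, 0 <= x t) ->
  tits2 (@dynkinE 7) x = 2 -> \sum_t x t <= 17%N%:Z.
Proof.
have [f ->] := ord_fun_nat x; rewrite tits2_dynkinE7 => /nat_of_int_fun f0.
rewrite !big_ord_recl big_ord0 /=.
have [a0 ->] := f0 0%N isT.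
have [a1 ->] := f0 1%N isT.
have [a2 ->] := f0 2%N isT.
have [a3 ->] := f0 3%N isT.
have [a4 ->] := f0 4%N isT.
have [a5 ->] := f0 5%N isT.
have [a6 ->] := f0 6%N isT.
move=> q2; have [] := @e8_form_height a0 a1 a2 a3 a4 a5 0%N a6 (mul2_eq2 q2); lia.
Qed.

Lemma dynkinE6_bound (x : 'I_6 -> int) t : `|x t| <= 100%:R * tits2 (@dynkinE 6) x.
Proof.
have [f ->] := ord_fun_nat x; rewrite tits2_dynkinE6 mulrA.
have [h0 [h1 [h2 [h3 [h4 [h5 [h6 h7]]]]]]] := e8_form_bound (f 0%N) (f 1%N) (f 2%N) (f 3%N) (f 4%N) 0 0 (f 5%N).
by case: t => -[|[|[|[|[|[|]]]]]].
Qed.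

Lemma dynkinE6_height (x : 'I_6 -> int) : (forall t, 0 <= x t) ->
  tits2 (@dynkinE 6) x = 2 -> \sum_t x t <= 11%N%:Z.
Proof.
have [f ->] := ord_fun_nat x; rewrite tits2_dynkinE6 => /nat_of_int_fun f0.
rewrite !big_ord_recl big_ord0 /=.
have [a0 ->] := f0 0%N isT.
have [a1 ->] := f0 1%N isT.
have [a2 ->] := f0 2%N isT.
have [a3 ->] := f0 3%N isT.
have [a4 ->] := f0 4%N isT.
have [a5 ->] := f0 5%N isT.
move=> q2; have [] := @e8_form_height a0 a1 a2 a3 a4 0%N 0%N a5 (mul2_eq2 q2); lia.
Qed.

(** Coefficients of the highest roots, along the chain and then at the short arm. *)
Definition e8_highest (i : nat) : int := (nth 0%N [:: 2; 4; 6; 5; 4; 3; 2; 3] i)%N%:Z.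
Definition e7_highest (i : nat) : int := (nth 0%N [:: 2; 3; 4; 3; 2; 1; 2] i)%N%:Z.
Definition e6_highest (i : nat) : int := (nth 0%N [:: 1; 2; 3; 2; 1; 2] i)%N%:Z.

Local Close Scope ring_scope.

Theorem proposition3p2 (K : closedFieldType) (Q : quiver)
    (Qconnected : connected Q) (Qacyclic : acyclic Q)
    (Lfinite : representation_finite (pathalg K Q))
    (Lhereditary : hereditary (pathalg K Q)) :
  [/\ forall n : nat, (4 <= n)%N -> underlying_graph_is Q (@dynkinD n) ->
        nakayama (pathalg K Q) (2 * n - 3)%N,
      underlying_graph_is Q (@dynkinE 6) -> nakayama (pathalg K Q) 11,
      underlying_graph_is Q (@dynkinE 7) -> nakayama (pathalg K Q) 17
    & underlying_graph_is Q (@dynkinE 8) -> nakayama (pathalg K Q) 29].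
Proof.
split.
- case=> [|[|[|[|m]]]] // _ QD; have [theta [th0 th2 thh]] := dynkinD_highest_root m.
  apply: (nakayama_graph K Qacyclic QD (@dynkinD_irr m.+1) (@dynkinD_bound m.+1) _
    (@dynkinD_height m.+1) th0 th2 thh).
  (* The height must exceed the number of vertices: [n < 2n - 3] holds from [n = 4] on. *)
  by rewrite card_ord; lia.
- move=> QE; apply: (@nakayama_graph K Q _ _ 100 11 (fun i : 'I_6 => e6_highest i) Qacyclic QE).
  + exact: dynkinE_irr.
  + exact: dynkinE6_bound.
  + by rewrite card_ord.
  + exact: dynkinE6_height.
  + by [].
  + by rewrite tits2_dynkinE6.
  + by rewrite !big_ord_recl big_ord0.
- move=> QE; apply: (@nakayama_graph K Q _ _ 100 17 (fun i : 'I_7 => e7_highest i) Qacyclic QE).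
  + exact: dynkinE_irr.
  + exact: dynkinE7_bound.
  + by rewrite card_ord.
  + exact: dynkinE7_height.
  + by [].
  + by rewrite tits2_dynkinE7.
  + by rewrite !big_ord_recl big_ord0.
- move=> QE; apply: (@nakayama_graph K Q _ _ 100 29 (fun i : 'I_8 => e8_highest i) Qacyclic QE).
  + exact: dynkinE_irr.
  + exact: dynkinE8_bound.
  + by rewrite card_ord.
  + exact: dynkinE8_height.
  + by [].
  + by rewrite tits2_dynkinE8.
  + by rewrite !big_ord_recl big_ord0.
Qed.
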